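(* Let $G \in \mathscr S$. There exists a finite set of primes $\eta = \eta(G)$ such that (i) and (ii) below hold; moreover (iii) and (iv) hold. (i) Every locally normal subgroup of $G$ is virtually a pro-$\eta$ group. In particular, the open pro-$\eta$ subgroups of $G$ form a basis of identity neighbourhoods. (ii) For every $p \in \eta$, every locally normal subgroup $L \neq \{e\}$ of $G$ has an infinite pro-$p$ subgroup. (iii) If some non-trivial locally normal subgroup of $G$ is virtually pro-soluble, then so is every compact open subgroup of $G$. (iv) The only virtually soluble locally normal subgroup of $G$ is the trivial subgroup $\{e\}$.
   Context: $\mathscr S$ denotes the class of compactly generated locally compact groups that are totally disconnected, topologically simple, and non-discrete. A locally normal subgroup of $G$ is a compact subgroup of $G$ whose normaliser in $G$ is open. For a set of primes $\eta$, a pro-$\eta$ group is a profinite group that is an inverse limit of finite groups whose orders are divisible only by primes in $\eta$. A profinite group is virtually pro-$\eta$ (resp. virtually pro-soluble) if it has an open subgroup that is pro-$\eta$ (resp. pro-soluble). *)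

(* Defs.v *)
From HB Require Import structures.
From mathcomp Require Export all_boot fingroup nilpotent.
From mathcomp Require Export finmap.
From mathcomp Require Export all_classical topology.

Set Implicit Arguments.
Unset Strict Implicit.
Unset Printing Implicit Defensive.

Local Open Scope classical_set_scope.
Local Open Scope group_scope.

HB.mixin Record isTopologicalGroup G & Topological G & monoid.Group G := {
  mulg_continuous : continuous (fun xy : G * G => xy.1 * xy.2);
  invg_continuous : continuous (fun x : G => x^-1)
}.

#[short(type="topologicalGroupType")]
HB.structure Definition TopologicalGroup :=
  {G of Topological G & monoid.Group G & isTopologicalGroup G}.

Section Subgroups.
Context {G : groupType}.
Implicit Types H K : set G.

Definition is_subgroup H :=
  [/\ H 1, (forall x y, H x -> H y -> H (x * y)) & forall x, H x -> H x^-1].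

Definition gen (A : set G) : set G := smallest is_subgroup A.

Definition normaliser H : set G := [set g | (fun x => x ^ g) @` H = H].

Definition is_normal H := is_subgroup H /\ normaliser H = [set: G].

Definition finite_index K H :=
  finite_set [set [set x * k | k in K] | x in H].

Definition derived H : set G :=
  gen [set z | exists x y, [/\ H x, H y & z = [~ x, y]]].

Definition soluble H := exists n, iter n derived H = [set 1].

Definition virtually_soluble H :=
  exists K, [/\ is_subgroup K, K `<=` H, finite_index K H & soluble K].

End Subgroups.

(* The index set is a nonempty directed preorder; the transition maps are not
   required to be surjective. *)
Record inverse_system := InverseSystem {
  idx : Type;
  idx_le : idx -> idx -> Prop;
  idx_inhabited : inhabited idx;
  idx_refl : forall i, idx_le i i;
  idx_trans : forall i j k, idx_le i j -> idx_le j k -> idx_le i k;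
  idx_directed : forall i j, exists k, idx_le i k /\ idx_le j k;
  obj : idx -> finGroupType;
  trans : forall i j, idx_le i j -> {multiplicative obj j -> obj i};
  trans_id : forall i (h : idx_le i i) x, trans h x = x;
  trans_comp : forall i j k (hij : idx_le i j) (hjk : idx_le j k)
    (hik : idx_le i k) x, trans hij (trans hjk x) = trans hik x
}.

(* The limit is the set of threads in the product of the finite groups, each
   taken with its discrete topology. *)
Definition inv_prod (S : inverse_system) : topologicalType :=
  prod_topology (fun i : idx S => discrete_topology (obj i)).

Definition inv_limit S : set (inv_prod S) :=
  [set x | forall i j (h : idx_le i j), trans h (x j : obj j) = x i].

Arguments inv_limit : clear implicits.

Section ProC.
Context {G : topologicalGroupType}.
Implicit Types (H L : set G) (C : finGroupType -> Prop).

(* Isomorphism of topological groups between H and the inverse limit; [f] and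
   [g] are total functions whose values outside H and outside the limit are
   irrelevant. *)
Definition is_inverse_limit H (S : inverse_system) :=
  exists (f : G -> inv_prod S) (g : inv_prod S -> G),
    [/\ set_fun H (inv_limit S) f /\ set_fun (inv_limit S) H g,
        {in H, cancel f g} /\ {in inv_limit S, cancel g f},
        forall x y i, H x -> H y ->
          f (x * y) i = (f x i : obj i) * (f y i : obj i) :> obj i,
        {within H, continuous f}
      & {within inv_limit S, continuous g}].

Definition pro C H :=
  is_subgroup H /\
  exists S : inverse_system, (forall i : idx S, C (obj i)) /\ is_inverse_limit H S.

Definition pro_pi (pi : nat_pred) : set G -> Prop :=
  pro (fun gT => pi.-nat #|gT|).

Definition pro_soluble : set G -> Prop :=
  pro (fun gT => solvable [set: gT]%G).

Definition virtually (P : set G -> Prop) L :=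
  exists U : set G, [/\ is_subgroup U, exists2 V, open V & U = L `&` V & P U].

Definition locally_normal L :=
  [/\ is_subgroup L, compact L & open (normaliser L)].

End ProC.

Definition compactly_generated (G : topologicalGroupType) :=
  exists2 K : set G, compact K & gen K = [set: G].

Definition topologically_simple (G : topologicalGroupType) :=
  [set: G] <> [set 1] /\
  forall N : set G, is_normal N -> closed N -> N = [set 1] \/ N = [set: G].

Record class_S (G : topologicalGroupType) : Prop := ClassS {
  (* Hausdorff is part of the usual meaning of "locally compact group"; it also
     follows from total disconnectedness. *)
  class_S_hausdorff : hausdorff_space G;
  class_S_locally_compact : locally_compact [set: G];
  class_S_compactly_generated : compactly_generated G;
  class_S_totally_disconnected : totally_disconnected [set: G];
  class_S_topologically_simple : topologically_simple G;
  class_S_nondiscrete : ~ (forall A : set G, open A)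
}.

(* Main.v *)
From HB Require Import structures.
From mathcomp Require Import pgroup sylow morphism quotient gproduct perm.
Require Import Defs.

(* Let U be a compact open subgroup and L a non-trivial locally normal subgroup.
   Since G is topologically simple and compactly generated, G is generated by U
   and finitely many elements l_i of conjugates L_i of L.  A small open V, normal
   in U, normalises every L_i; let E be generated by the U-conjugates of the
   L_i `&` V.  As [l_i, V] lies in L_i, near 1 each l_i acts trivially modulo E.
   In the Cayley-Abels graph this means that an element fixing a large ball acts
   near each point of the ball, up to conjugation, as an element of E.  So if L is
   virtually pro-C, for a class C of finite groups closed under subgroups, quotients
   and extensions, then the successive quotients of the pointwise stabilisers of
   balls are in C, and G is locally pro-C.  The same filtration with E = U shows
   that only finitely many primes occur locally.  Taking for C the p'-groups and
   keeping the primes p for which G is not locally pro-p' gives (i) and, by Sylow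
   theory, (ii); the soluble groups give (iii).

   For (iv), E is soluble and commensurated by G.  Shrink E until its derived
   length is least possible among its open subgroups; the last non-trivial term N
   of its derived series is abelian.  Generators of G taken in U and in conjugates
   of N normalise the corresponding term for a smaller open subgroup of E, which is
   then a non-trivial normal subgroup of G contained in U. *)

Set Implicit Arguments.
Unset Strict Implicit.
Unset Printing Implicit Defensive.

Local Open Scope classical_set_scope.
Local Open Scope group_scope.

(** * Classes of finite groups and finite quotients *)

(** Membership is a predicate on subgroups of finite groups; closure under images of morphisms
    includes invariance under isomorphism. The instances used are the pi-groups and the soluble
    groups. *)
Record finclass := Finclass {
  fc_mem :> forall gT : finGroupType, {group gT} -> Prop;
  fc_sub : forall (gT : finGroupType) (A B : {group gT}),
    B \subset A -> fc_mem A -> fc_mem B;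
  fc_morphim : forall (gT hT : finGroupType) (A : {group gT})
    (f : {morphism A >-> hT}), fc_mem A -> fc_mem (f @* A)%G;
  fc_ext : forall (gT : finGroupType) (A B : {group gT}),
    B <| A -> fc_mem B -> fc_mem (A / B)%G -> fc_mem A
}.

Definition pi_class (pi : nat_pred) : finclass.
Proof.
exists (fun gT A => pi.-group A).
- by move=> gT A B; apply: pgroupS.
- by move=> gT hT A f; apply: morphim_pgroup.
- by move=> gT A B nBA pB pAB; rewrite -(pquotient_pgroup pB) ?normal_norm.
Defined.

Definition solvable_class : finclass.
Proof.
exists (fun gT A => solvable A).
- by move=> gT A B; apply: solvableS.
- by move=> gT hT A f; apply: morphim_sol.
- by move=> gT A B nBA sB sAB; rewrite (series_sol nBA) sB.
Defined.

Section Join.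
Variables (P : finclass) (gT : finGroupType).
Implicit Types A B R : {group gT}.

(** The quotient of [A <*> B] by [A] is an image of [B], so closure under extensions applies. *)
Lemma fc_joing A B : A <| A <*> B -> P gT A -> P gT B -> P gT (A <*> B)%G.
Proof.
move=> nA PA PB; apply: (fc_ext nA PA).
have nBA : B \subset 'N(A).
  by rewrite (fintype.subset_trans (joing_subr A B)) ?normal_norm.
have -> : ((A <*> B) / A)%G = (B / A)%G.
  by apply: val_inj; rewrite /= norm_joinEr // quotientMidl.
have := @fc_morphim P _ _ _ (restrm_morphism nBA (coset_morphism A)) PB.
by congr (P _ _); apply: val_inj; rewrite /= morphim_restrm finset.setIid.
Qed.

(** Take [R] of largest order among the normal subgroups in the class: its product with another one
    is again normal and in the class, hence equal to [R]. *)
Lemma fc_radical (G : {group gT}) : P gT 1%G ->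
  exists2 R : {group gT}, P gT R &
    forall A, A <| G -> P gT A -> A \subset R.
Proof.
move=> P1.
pose Q (R : {group gT}) := `[< R <| G /\ P gT R >].
have [] := @arg_maxnP _ 1%G Q (fun R => #|R|).
  by apply/asboolP; split=> //; apply: normal1.
move=> R /asboolP[nR PR] maxR; exists R => // A nA PA.
have nRA : R <| R <*> A.
  rewrite /normal joing_subl join_subG normG.
  by rewrite (fintype.subset_trans (normal_sub nA)) ?normal_norm.
have /maxR : Q (R <*> A)%G.
  by apply/asboolP; split; [exact: normalY|exact: fc_joing].
move=> le; have := joing_subr R A.
by have /eqP <- : R :==: R <*> A by rewrite eqEcard joing_subl.
Qed.

End Join.

Section Quotients.
Variable G : groupType.
Implicit Types (H K N M : set G).

Lemma subgroup1 H : is_subgroup H -> H 1. Proof. by case. Qed.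
Lemma subgroupM H x y : is_subgroup H -> H x -> H y -> H (x * y).
Proof. by case=> _ + _; apply. Qed.
Lemma subgroupV H x : is_subgroup H -> H x -> H x^-1.
Proof. by case=> _ _; apply. Qed.
Lemma subgroupJ H x y : is_subgroup H -> H x -> H y -> H (x ^ y).
Proof. by move=> sH Hx Hy; apply: subgroupM (subgroupM sH Hx Hy) => //; apply: subgroupV. Qed.

Definition morph_on H (hT : groupType) (f : G -> hT) :=
  forall x y, H x -> H y -> f (x * y) = f x * f y.

Lemma morph_on1 H (hT : groupType) (f : G -> hT) :
  is_subgroup H -> morph_on H f -> f 1 = 1.
Proof.
move=> [H1 _ _] /(_ 1 1 H1 H1); rewrite mulg1 => e.
by apply: (mulgI (f 1)); rewrite -e mulg1.
Qed.

Lemma morph_onV H (hT : groupType) (f : G -> hT) x :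
  is_subgroup H -> morph_on H f -> H x -> f x^-1 = (f x)^-1.
Proof.
move=> sH mf Hx; have Hx' := subgroupV sH Hx.
by apply: (mulgI (f x)); rewrite -mf // !mulgV (morph_on1 sH).
Qed.

Lemma morph_onJ H (hT : groupType) (f : G -> hT) x y :
  is_subgroup H -> morph_on H f -> H x -> H y -> f (x ^ y) = f x ^ f y.
Proof.
move=> sH mf Hx Hy; have Hy' := subgroupV sH Hy.
rewrite !conjgE !mf ?(morph_onV sH) //; exact: subgroupM.
Qed.

Definition ker_on H (hT : groupType) (f : G -> hT) := [set x | H x /\ f x = 1].

Lemma ker_on_subgroup H (hT : groupType) (f : G -> hT) :
  is_subgroup H -> morph_on H f -> is_subgroup (ker_on H f).
Proof.
move=> sH mf; split; first by split; [exact: subgroup1|exact: morph_on1 mf].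
  by move=> x y [Hx fx] [Hy fy]; split; [exact: subgroupM|rewrite mf // fx fy mulg1].
move=> x [Hx fx]; split; first exact: subgroupV.
by rewrite (morph_onV sH) // fx invg1.
Qed.

Lemma image_group H (hT : finGroupType) (f : G -> hT) :
  is_subgroup H -> morph_on H f ->
  exists B : {group hT}, forall y, y \in B <-> exists2 x, H x & f x = y.
Proof.
move=> sH mf; pose B := [set y | `[< exists2 x, H x & f x = y >]]%SET.
have gB : group_set B.
  apply/group_setP; split.
    by rewrite !inE; exists 1; [exact: subgroup1|exact: morph_on1 mf].
  move=> a b; rewrite !inE => -[x Hx <-] [y Hy <-].
  by exists (x * y); [exact: subgroupM|exact: mf].
by exists (Group gB) => y; rewrite !inE.
Qed.

Lemma morph_on_factor H (gT hT : finGroupType) (f : G -> gT) (t : G -> hT)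
    (A : {group gT}) :
  is_subgroup H -> morph_on H f -> morph_on H t -> ker_on H f `<=` ker_on H t ->
  (forall y, y \in A <-> exists2 x, H x & f x = y) ->
  exists g : {morphism A >-> hT}, forall x, H x -> g (f x) = t x.
Proof.
move=> sH mf mt sub AP.
(* The default value 1 is taken only off [A], the image of [f], where nothing is required of [g]. *)
pose g (y : gT) : hT := xget 1 [set z | exists x, [/\ H x, f x = y & t x = z]].
have gE x : H x -> g (f x) = t x.
  move=> Hx; rewrite /g; case: xgetP => [z -> [x' [Hx' fx' <-]]|/(_ (t x))]; last first.
    by case; exists x.
  have [] := sub (x'^-1 * x).
    split; first by apply: subgroupM => //; apply: subgroupV.
    by rewrite mf ?(morph_onV sH) ?fx' ?mulVg //; apply: subgroupV.
  rewrite mt ?(morph_onV sH) //; last exact: subgroupV.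
  by move=> _ /(congr1 (fun z => t x' * z)); rewrite mulKVg mulg1.
have mg : {in A &, {morph g : x y / x * y}}.
  move=> _ _ /AP[x Hx <-] /AP[y Hy <-].
  by rewrite -mf // !gE ?mt //; apply: subgroupM.
by exists (Morphism mg).
Qed.

Variable P : finclass.

(* [A] need only contain the image of [f]: classes are closed under subgroups. *)
Definition quot_in H N := exists (gT : finGroupType) (A : {group gT}) (f : G -> gT),
  [/\ P gT A, forall x, H x -> f x \in A, morph_on H f & N = ker_on H f].

Lemma quot_in_subgroup H N : is_subgroup H -> quot_in H N -> is_subgroup N.
Proof. by move=> sH [gT [A [f [_ _ mf ->]]]]; apply: ker_on_subgroup. Qed.

Lemma quot_in_sub H N : quot_in H N -> N `<=` H.
Proof. by move=> [gT [A [f [_ _ _ ->]]]] x []. Qed.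

Lemma quot_in_pullback H N K (c : G -> G) :
  (forall x, K x -> H (c x)) -> morph_on K c ->
  quot_in H N -> quot_in K [set x | K x /\ N (c x)].
Proof.
move=> cK mc [gT [A [f [PA fA mf ->]]]]; exists gT, A, (f \o c); split=> //.
- by move=> x Kx; apply/fA/cK.
- by move=> x y Kx Ky; rewrite /= mc // mf //; apply: cK.
apply/seteqP; split=> x; first by move=> [Kx [_ fcx]].
by move=> [Kx fcx]; split=> //; split=> //; apply: cK.
Qed.

Lemma quot_inS H N K : K `<=` H -> quot_in H N -> quot_in K (K `&` N).
Proof.
move=> KH qHN; have := @quot_in_pullback H N K id KH _ qHN.
exact.
Qed.

(** By [morph_on_factor], [t] factors through the image of [H] in a group of the class, so [B] lies
    in a homomorphic image of such a group. *)
Lemma quot_in_image H N (hT : finGroupType) (t : G -> hT) (B : {group hT}) :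
  is_subgroup H -> morph_on H t -> quot_in H N -> N `<=` ker_on H t ->
  (forall y, y \in B -> exists2 x, H x & t x = y) -> P hT B.
Proof.
move=> sH mt [gT [A [f [PA fA mf ->]]]] sub BH.
have [A1 A1P] := image_group sH mf.
have PA1 : P gT A1.
  by apply: fc_sub PA; apply/fintype.subsetP => _ /A1P[x Hx <-]; apply: fA.
have [g gE] := morph_on_factor sH mf mt sub A1P.
have := @fc_morphim P _ _ _ g PA1.
apply: fc_sub; apply/fintype.subsetP => y /BH[x Hx <-]; rewrite -gE //.
by apply/morphimP; exists (f x) => //; apply/A1P; exists x.
Qed.

End Quotients.

Section FiniteQuotients.
Variable G : groupType.
Implicit Types (H K N M : set G).

Definition fin_quot H N :=
  exists (gT : finGroupType) (f : G -> gT), morph_on H f /\ N = ker_on H f.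

(** [H] permutes the finitely many cosets of [N] by right translation, and the kernel of this action
    is [N] because [N] is normal in [H]. *)
Lemma fin_quot_cosets H N (s : seq G) : is_subgroup H -> is_subgroup N -> N `<=` H ->
    (forall x y, N x -> H y -> N (x ^ y)) ->
    (forall x, H x -> exists h, [/\ h \in s, H h & N (x * h^-1)]) ->
  fin_quot H N.
Proof.
move=> sH sN NH nN cov.
pose rc x : set G := [set n * x | n in N].
have rcE x y : rc x = rc y <-> N (x * y^-1).
  split=> [e|Nxy].
    have : rc y x by rewrite -e; exists 1; [exact: subgroup1|rewrite mul1g].
    by case=> n Nn <-; rewrite mulgK.
  apply/seteqP; split=> _ [n Nn <-].
    by exists (n * (x * y^-1)); [exact: subgroupM|rewrite -!mulgA mulVg mulg1].
  exists (n * (x * y^-1)^-1); first by apply: subgroupM => //; apply: subgroupV.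
  by rewrite invgM invgK -!mulgA mulVg mulg1.
(* The cosets form a finite set of sets, so that [{perm Q}] is a finite group. *)
pose Q : {fset set G} := [fset rc h | h in [seq h <- s | `[< H h >]]]%fset.
have QE A : A \in Q <-> exists2 h, H h & A = rc h.
  split=> [/imfsetP[h /=]|[x Hx ->]].
    by rewrite mem_filter => /andP[/asboolP Hh _] ->; exists h.
  have [h [hs Hh Nxh]] := cov _ Hx.
  apply/imfsetP; exists h; last exact/rcE.
  by rewrite /= mem_filter hs andbT; apply/asboolP.
pose tr (A : set G) x : set G := [set a * x | a in A].
have trE x y : tr (rc x) y = rc (x * y).
  apply/seteqP; split=> [_ [_ [n Nn <-] <-]|_ [n Nn <-]].
    by exists n => //; rewrite mulgA.
  by exists (n * x); [exists n|rewrite mulgA].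
pose acts x (p : {perm Q}) := forall A, val (p A) = tr (val A) x.
have actsP x : H x -> exists p, acts x p.
  move=> Hx.
  have stab (A : Q) : tr (val A) x \in Q.
    have /QE[h Hh ->] := valP A; rewrite trE; apply/QE.
    by exists (h * x) => //; apply: subgroupM.
  pose g A : Q := Sub (tr (val A) x) (stab A).
  have gI : injective g.
    move=> A B /(congr1 val) /=.
    have /QE[a Ha eA] := valP A; have /QE[b Hb eB] := valP B.
    rewrite eA eB !trE => /rcE; rewrite invgM mulgA mulgK => /rcE e.
    by apply: val_inj; rewrite /= eA eB.
  by exists (perm gI) => A; rewrite permE.
have actsU x p q : acts x p -> acts x q -> p = q.
  by move=> hp hq; apply/perm.permP => A; apply: val_inj; rewrite hp hq.
pose f x : {perm Q} := xget 1 [set p | acts x p].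
have fP x : H x -> acts x (f x).
  by move=> /actsP[p hp]; apply: (@xgetPex _ 1 [set p | acts x p]); exists p.
exists _, f; split.
  move=> x y Hx Hy; apply: (actsU (x * y)); first by apply: fP; apply: subgroupM.
  move=> A; rewrite permM !fP //; have /QE[h Hh ->] := valP A.
  by rewrite !trE mulgA.
apply/seteqP; split=> x; rewrite /ker_on /=.
  move=> Nx; have Hx := NH _ Nx; split=> //.
  apply: (actsU x); first exact: fP.
  move=> A; rewrite perm1; have /QE[h Hh ->] := valP A.
  rewrite trE; apply/rcE; rewrite invgM !mulgA.
  suff -> : h * x^-1 * h^-1 = x^-1 ^ h^-1 by apply: nN; exact: subgroupV.
  by rewrite conjgE invgK mulgA.
(* Conversely, an element acting trivially fixes the coset of 1, so it lies in [N]. *)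
case=> Hx fx; have := fP _ Hx; rewrite fx.
have h1 : rc 1 \in Q by apply/QE; exists 1 => //; apply: subgroup1.
move=> /(_ (Sub (rc 1) h1)); rewrite perm1 /= trE mul1g => /esym/rcE.
by rewrite invg1 mulg1.
Qed.

Lemma fin_quotI H N M : fin_quot H N -> fin_quot H M -> fin_quot H (N `&` M).
Proof.
move=> [gT [f [mf ->]]] [hT [g [mg ->]]].
exists (gT * hT)%type, (fun x => (f x, g x)); split.
  by move=> x y Hx Hy; rewrite mf // mg.
apply/seteqP; split=> x; first by move=> [[Hx fx] [_ gx]]; split; rewrite // fx gx.
by move=> [Hx [fx gx]].
Qed.

Lemma fin_quotS H N K : K `<=` H -> fin_quot H N -> fin_quot K (K `&` N).
Proof.
move=> KH [gT [f [mf ->]]]; exists gT, f; split.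
  by move=> x y Kx Ky; apply: mf; apply: KH.
by apply/seteqP; split=> x [Kx]; [case|split=> //; split=> //; exact: KH].
Qed.

Variable P : finclass.

Lemma quot_in_fin H N : quot_in P H N -> fin_quot H N.
Proof. by move=> [gT [A [f [_ _ mf eN]]]]; exists gT, f. Qed.

(** [H / N] is an extension with kernel [M / N] and quotient [H / M]. The hypothesis [fin_quot H N]
    makes [N] normal in [H] and supplies one finite group containing both images. *)
Lemma quot_in_trans H M N : is_subgroup H -> fin_quot H N ->
  quot_in P H M -> quot_in P M N -> quot_in P H N.
Proof.
move=> sH [hT [t [mt eN]]] qHM qMN.
have MH := quot_in_sub qHM; have sM := quot_in_subgroup sH qHM.
have NM := quot_in_sub qMN.
have [A AE] := image_group sH mt.
have mtM : morph_on M t by move=> x y Mx My; apply: mt; apply: MH.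
have [B BE] := image_group sM mtM.
exists hT, A, t; split=> //; last by move=> x Hx; apply/AE; exists x.
have nBA : B <| A.
  apply/andP; split.
    by apply/fintype.subsetP => _ /BE[x Mx <-]; apply/AE; exists x => //; apply: MH.
  apply/fintype.subsetP => _ /AE[x Hx <-]; rewrite inE; apply/fintype.subsetP => y.
  rewrite mem_conjg => /BE[z Mz ez]; apply/BE; exists (z ^ x).
    case: qHM Mz => gT [C [f [_ _ mf ->]]] [Hz fz].
    by split; [exact: subgroupJ|rewrite (morph_onJ sH) // fz conj1g].
  by rewrite (morph_onJ sH) // ?ez ?conjgKV //; apply: MH.
apply: (fc_ext nBA).
  apply: (quot_in_image sM mtM qMN); last by move=> y /BE.
  by move=> x Nx; split; [exact: NM|move: Nx; rewrite eN => -[]].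
have nB x : H x -> t x \in 'N(B)%SET.
  by move=> Hx; apply: (fintype.subsetP (normal_norm nBA)); apply/AE; exists x.
apply: (quot_in_image (t := fun x => coset B (t x)) sH _ qHM).
- by move=> x y Hx Hy; rewrite mt // morphM //; apply: nB.
- move=> x Mx; split; first exact: MH.
  by apply: coset_id; apply/BE; exists x.
- move=> _ /morphimP[y nBy /AE[x Hx <-] ->]; by exists x.
Qed.

Lemma quot_inI H N M : is_subgroup H -> quot_in P H N -> quot_in P H M ->
  quot_in P H (N `&` M).
Proof.
move=> sH qN qM; have NH := quot_in_sub qN.
apply: (quot_in_trans sH _ qN); first by apply: fin_quotI; apply: quot_in_fin.
exact: quot_inS qM.
Qed.

Lemma quot_inT H : is_subgroup H -> (forall gT : finGroupType, P gT 1%G) -> quot_in P H H.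
Proof.
(* [{perm bool}] is an arbitrary finite group, of which only the trivial subgroup matters. *)
move=> sH P1; exists {perm bool}, 1%G, (fun=> 1); split=> //.
  by move=> x y _ _; rewrite mulg1.
by apply/seteqP; split=> x //; case.
Qed.

(* Finitely many members of the family already have intersection [N], since
   [H / N] is finite. *)
Lemma quot_in_bigcap (I : Type) (D : set I) (F : I -> set G) H N :
    (forall gT : finGroupType, P gT 1%G) ->
    is_subgroup H -> fin_quot H N ->
    (forall i, D i -> quot_in P H (F i)) ->
    N = [set x | H x /\ forall i, D i -> F i x] ->
  quot_in P H N.
Proof.
move=> P1 sH [gT [f [mf eN]]] qF eN'.
(* [y] is good if some [M] containing [N], with quotient in the class, misses the fibre of [f] over
   [y]. Every [y] other than 1 is good, and intersecting along [enum gT] cuts down to [N]. *)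
pose good (y : gT) := exists2 M, quot_in P H M & N `<=` M /\ ~ (exists2 x, M x & f x = y).
have goodP y : y != 1 -> good y.
  move=> y1; have [[x Hx fx]|no] := pselect (exists2 x, H x & f x = y); last first.
    exists H; first exact: quot_inT.
    by split=> // x; rewrite eN' => -[].
  have : ~ N x by rewrite eN => -[_ fx1]; move: y1; rewrite -fx fx1 eqxx.
  rewrite {1}eN' => /not_andP[//|/existsNP[i /not_implyP[Di nFx]]].
  exists (F i); first exact: qF.
  split=> [z|[z Fz fz]]; first by rewrite eN' => -[_]; apply.
  apply: nFx.
  have sF := quot_in_subgroup sH (qF i Di).
  have Hz := quot_in_sub (qF i Di) Fz.
  have : N (z^-1 * x).
    rewrite eN; split; first by apply: subgroupM => //; apply: subgroupV.
    by rewrite mf ?(morph_onV sH) ?fx ?fz ?mulVg //; apply: subgroupV.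
  rewrite eN' => -[_ /(_ i Di) Fzx].
  by rewrite -(mulKVg z x); apply: subgroupM.
suff [M qM [NM noM]] : exists2 M, quot_in P H M &
    N `<=` M /\ (forall x, M x -> f x \in enum gT -> f x = 1).
  suff -> : N = M by [].
  apply/seteqP; split=> // x Mx; rewrite eN; split; first exact: (quot_in_sub qM).
  by apply: noM => //; rewrite mem_enum.
elim: (enum gT) => [|y s [M qM [NM noM]]].
  by exists H; [exact: quot_inT|split=> // x; rewrite eN' => -[]].
have [->|/goodP[M' qM' [NM' noM']]] := eqVneq y 1.
  by exists M => //; split=> // x Mx; rewrite inE => /orP[/eqP|/noM -> //].
exists (M `&` M'); first exact: quot_inI.
split=> [x Nx|x [Mx M'x]]; first by split; auto.
rewrite inE => /orP[/eqP fx|/noM -> //].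
by case: noM'; exists x.
Qed.

End FiniteQuotients.

(** * Topological groups *)

Section Top.
Variable G : topologicalGroupType.
Implicit Types (A B H K U W : set G).

Lemma mul_cvg (T : Type) (F : set_system T) (f g : T -> G) (a b : G) : Filter F ->
  f @ F --> a -> g @ F --> b -> (fun x => f x * g x) @ F --> a * b.
Proof.
move=> FF fa gb; have /= := @mulg_continuous G (a, b).
move=> /(cvg_comp _ _ (cvg_pair fa gb)).
exact.
Qed.

Lemma inv_cvg (T : Type) (F : set_system T) (f : T -> G) (a : G) :
  f @ F --> a -> (fun x => (f x)^-1) @ F --> a^-1.
Proof. by move=> fa; apply: (cvg_comp _ _ fa); apply: invg_continuous. Qed.

Lemma conj_cvg (T : Type) (F : set_system T) (f g : T -> G) (a b : G) : Filter F ->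
  f @ F --> a -> g @ F --> b -> (fun x => f x ^ g x) @ F --> a ^ b.
Proof.
move=> FF fa gb.
refine (@mul_cvg T F (fun x => (g x)^-1) (fun x => f x * g x)
  b^-1 (a * b) FF (inv_cvg gb) (mul_cvg FF fa gb)).
Qed.

Lemma mulr_continuous (b : G) : continuous (fun x : G => x * b).
Proof. by move=> x; apply: mul_cvg; [exact: cvg_id|exact: cvg_cst]. Qed.
Lemma mull_continuous (b : G) : continuous (fun x : G => b * x).
Proof. by move=> x; apply: mul_cvg; [exact: cvg_cst|exact: cvg_id]. Qed.
Lemma conj_continuous (b : G) : continuous (fun x : G => x ^ b).
Proof. by move=> x; apply: conj_cvg; [exact: cvg_id|exact: cvg_cst]. Qed.

Lemma nbhs_preim (f : G -> G) (x y : G) W : f @ x --> y -> nbhs y W -> nbhs x (f @^-1` W).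
Proof. by move=> fx /fx. Qed.

Lemma nbhs_mulr (x : G) W : nbhs x W <-> nbhs (1 : G) [set y | W (y * x)].
Proof.
split=> nW.
  by apply: (nbhs_preim (f := fun y => y * x)) nW; rewrite -{2}(mul1g x); apply: mulr_continuous.
have c : (fun y : G => y * x^-1) @ x --> (1 : G).
  by rewrite -(mulgV x); apply: mulr_continuous.
apply: filterS (nbhs_preim c nW) => y /=.
by rewrite mulgVK.
Qed.

Lemma nbhs_mul W : nbhs (1 : G) W ->
  exists2 V, nbhs (1 : G) V & forall x y, V x -> V y -> W (x * y).
Proof.
move=> nW; have := @mulg_continuous G (1, 1) W; rewrite /= mulg1 => /(_ nW).
case=> -[V1 V2] /= [n1 n2] sub; exists (V1 `&` V2); first exact: filterI.
by move=> x y [x1 _] [_ y2]; apply: (sub (x, y)).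
Qed.

Lemma nbhs_inv W : nbhs (1 : G) W -> nbhs (1 : G) [set x | W x^-1].
Proof.
move=> nW; apply: (nbhs_preim (f := fun x => x^-1)) nW.
by rewrite -{2}invg1; apply: invg_continuous.
Qed.

Lemma nbhs_conj (g : G) W : nbhs (1 : G) W -> nbhs (1 : G) [set x | W (x ^ g)].
Proof.
move=> nW; apply: (nbhs_preim (f := fun x => x ^ g)) nW.
by rewrite -{2}(conj1g g); apply: conj_continuous.
Qed.

Lemma subgroup_open H : is_subgroup H -> nbhs (1 : G) H -> open H.
Proof.
move=> sH nH; rewrite openE => x Hx; apply/nbhs_mulr.
by apply: filterS nH => y Hy; apply: subgroupM.
Qed.

Lemma subgroup_closed H : is_subgroup H -> nbhs (1 : G) H -> closed H.
Proof.
move=> sH nH x /(_ [set y | H (y * x^-1)]) [|y [Hy /= Hyx]].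
  apply/nbhs_mulr; apply: filterS nH => y Hy /=.
  by rewrite mulgK.
rewrite -(invgK x) -(mulg1 (x^-1^-1)) -(mulVg y) mulgA -invgM; apply: subgroupM => //.
  by apply: subgroupV.
Qed.

Lemma open_nbhs1 H : is_subgroup H -> open H -> nbhs (1 : G) H.
Proof. by move=> sH oH; apply: open_nbhs_nbhs; split=> //; exact: subgroup1. Qed.

(** Conjugation fixes 1, so continuity gives a neighbourhood for each [d]; compactness of [K] makes
    it uniform. *)
Lemma tube K W : compact K -> nbhs (1 : G) W ->
  \forall x \near (1 : G), forall d, K d -> W (x ^ d).
Proof.
move=> /compact_near_coveringP cK nW; apply: (cK _ _ (fun x d => W (x ^ d))) => d _.
have : (fun p : G * G => p.2 ^ p.1) @ (d, 1 : G) --> (1 : G) ^ d.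
  apply: conj_cvg; [exact: cvg_snd|exact: cvg_fst].
by rewrite conj1g => /(_ W nW).
Qed.

Lemma compact_finite_cosets K W : compact K -> nbhs (1 : G) W ->
  exists s : seq G, forall x, K x -> exists h, [/\ h \in s, K h & W (x * h^-1)].
Proof.
move=> cK nW.
pose pG : ptopologicalType := HB.pack (Topological.sort G) (isPointed.Build (G : Type) 1).
have := cK; rewrite (@compact_cover pG).
move=> /(_ G K (fun h => [set x | W (x * h^-1)]^°)).
case.
- by move=> i _; apply: open_interior.
- move=> x Kx; exists x => //; rewrite /interior /=; apply/nbhs_mulr.
  by apply: filterS nW => y Wy /=; rewrite mulgK.
move=> D DK cov; exists (enum_fset D) => x /cov[h hD /interior_subset Wx].
by exists h; split=> //; apply/set_mem/DK.
Qed.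

(** The traces of the [F i] on [K] generate a proper filter; a cluster point in [K] lies in every
    closed [F i]. *)
Lemma compact_directed K (I : Type) (D : set I) (F : I -> set G) :
    compact K -> (exists i, D i) -> (forall i, D i -> closed (F i)) ->
    (forall i, D i -> K `&` F i !=set0) ->
    (forall i j, D i -> D j -> exists2 k, D k & F k `<=` F i `&` F j) ->
  exists2 x, K x & forall i, D i -> F i x.
Proof.
move=> cK [i0 Di0] cF nF dF.
have FF : Filter (filter_from D F).
  by apply: filter_from_filter; [exists i0|move=> i j; apply: dF].
have PF : ProperFilter (filter_from D (fun i => K `&` F i)).
  apply: filter_from_proper => //; apply: filter_from_filter; first by exists i0.
  move=> i j Di Dj; have [k Dk Fk] := dF i j Di Dj.
  by exists k => // x [Kx /Fk[]].
have [|x [Kx clx]] := cK _ PF; first by exists i0 => // x [].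
exists x => // i Di; apply: cF => // B nB.
have [|y [[_ Fy] By]] := clx (K `&` F i) B _ nB; first by exists i.
by exists y.
Qed.

End Top.

(** * Van Dantzig's theorem *)

Section VanDantzig.
Variable G : topologicalGroupType.
Implicit Types (A B C H K U V W : set G).

(** Used for [chain C V], the points of [C] joined to 1 by a finite chain inside [C] with successive
    quotients in [V]. Their intersection over all [V] will be a connected set containing 1. *)
Definition step_closed C V A :=
  forall x y, A x -> C y -> V (y * x^-1) -> A y.

Definition chain C V := smallest (step_closed C V) [set 1].

Lemma chain1 C V : chain C V 1.
Proof. by move=> A [_]; apply. Qed.

Lemma chain_step C V : step_closed C V (chain C V).
Proof. by move=> x y cx Cy Vyx A [sA A1]; apply: (sA x) => //; apply: cx. Qed.

Lemma chain_sub C V : C 1 -> chain C V `<=` C.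
Proof. by move=> C1; apply: smallest_sub; [move=> ? ? _|move=> _ ->]. Qed.

Lemma chain_mono C V W : V `<=` W -> chain C V `<=` chain C W.
Proof.
move=> VW; apply: smallest_sub; last by move=> _ ->; exact: chain1.
by move=> x y cx Cy /VW; apply: chain_step.
Qed.

Lemma nbhs_mulrV (x : G) V : nbhs (1 : G) V -> nbhs x [set z | V (x * z^-1)].
Proof.
move=> nV; apply/nbhs_mulr; apply: filterS (nbhs_inv nV) => z /=.
by rewrite invgM mulgA mulgV mul1g.
Qed.

Lemma chain_closed C V : C 1 -> closed C -> nbhs (1 : G) V -> closed (chain C V).
Proof.
move=> C1 cC nV y cly.
have Cy : C y by apply: cC => B /cly [z [/(chain_sub C1) Cz Bz]]; exists z.
by have [z [cz Vyz]] := cly _ (nbhs_mulrV y nV); apply: chain_step cz _ _.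
Qed.

Lemma compact_sep A B : compact A -> closed B -> A `&` B = set0 ->
  exists2 V, nbhs (1 : G) V & forall a b, A a -> B b -> ~ V (b * a^-1).
Proof.
move=> /compact_near_coveringP cA cB dAB.
have nV : \forall v \near (1 : G), forall a, A a -> ~ B (v * a).
  apply: (cA _ _ (fun v a => ~ B (v * a))) => a Aa.
  have nB : nbhs a (~` B).
    apply: open_nbhs_nbhs; split; first exact: closed_openC.
    by move=> Ba; have : (A `&` B) a by []; rewrite dAB.
  have : (fun p : G * G => p.2 * p.1) @ (a, 1 : G) --> 1 * a.
    by apply: mul_cvg; [exact: cvg_snd|exact: cvg_fst].
  by rewrite mul1g => /(_ _ nB).
by eexists; [exact: nV|move=> a b Aa Bb /(_ a Aa); rewrite mulgVK].
Qed.

Lemma nbhs_mul3 W : nbhs (1 : G) W -> exists V, [/\ nbhs (1 : G) V,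
  (forall x, V x -> V x^-1) & forall x y z, V x -> V y -> V z -> W (x * y * z)].
Proof.
move=> /nbhs_mul[V1 nV1 V1W]; have [V2 nV2 V2V1] := nbhs_mul nV1.
pose V := V1 `&` V2; have nV : nbhs (1 : G) V by apply: filterI.
exists (V `&` [set x | V x^-1]); split.
- by apply: filterI => //; apply: nbhs_inv.
- by move=> x [Vx Vx'] ; split => //=; rewrite invgK.
- move=> x y z [[_ x2] _] [[_ y2] _] [[z1 _] _]; apply: V1W => //.
  exact: V2V1.
Qed.

Lemma nbhs1 V : nbhs (1 : G) V -> V 1. Proof. exact: nbhs_singleton. Qed.

(** Suppose that [Q] splits into disjoint closed sets [A], containing 1, and [B]. Thicken both so
    little that no [V]-step leads from [N A] to [N B]. Chains with fine enough steps stay in [N A]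
    or [N B], so those starting at 1 never leave [N A], and [B] is empty. *)
Lemma chain_connected C : compact C -> closed C -> C 1 ->
  connected (\bigcap_(V in nbhs (1 : G)) chain C V).
Proof.
move=> coC cC C1; set Q := (X in connected X).
have QC : Q `<=` C by move=> x /(_ _ filterT) /(chain_sub C1).
have cQ : closed Q.
  by apply: closed_bigI => V nV; apply: chain_closed.
have Q1 : Q 1 by move=> V _; apply: chain1.
have compact_sub A : closed A -> A `<=` Q -> compact A.
  by move=> cA /subset_trans /(_ QC); apply: subclosed_compact.
have sep A B : closed A -> closed B -> A `&` B = set0 -> Q = A `|` B -> A 1 ->
    B = set0.
  move=> cA cB dAB eQ A1.
  have cpA : compact A by apply: compact_sub => //; rewrite eQ; left.
  have [V0 nV0 sV0] := compact_sep cpA cB dAB.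
  have [V [nV Vinv VVV]] := nbhs_mul3 nV0.
  pose N E : set G := [set x | exists2 a, E a & V (x * a^-1)].
  have sN E : E `<=` N E by move=> a Ea; exists a => //; rewrite mulgV; apply: nbhs1.
  have nN E a : E a -> nbhs a (N E).
    move=> Ea; apply/nbhs_mulr; apply: filterS nV => v Vv; exists a => //.
    by rewrite mulgK.
  have sepN x y : N A x -> V (y * x^-1) -> N B y -> False.
    move=> [a Aa Vxa] Vyx [b Bb Vyb]; apply: (sV0 a b Aa Bb).
    have := VVV _ _ _ (Vinv _ Vyb) Vyx Vxa.
    by rewrite invgM invgK !mulgA !mulgVK.
  have QN : Q `<=` (N A `|` N B)^°.
    move=> x; rewrite {1}eQ => -[Ax|Bx]; rewrite /interior /=.
      by apply: filterS (nN A x Ax); left.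
    by apply: filterS (nN B x Bx); right.
  (* Otherwise compactness yields a point that all fine chains reach and that is not interior to the
     thickening; but such a point lies in [Q]. *)
  have [V1 [nV1 V1V sV1]] : exists V1, [/\ nbhs (1 : G) V1, V1 `<=` V &
      chain C V1 `<=` N A `|` N B].
    apply: contrapT => no.
    have [|||||x Cx xF] := @compact_directed G (C `&` ~` (N A `|` N B)^°) (set G)
        [set V1 | nbhs (1 : G) V1 /\ V1 `<=` V] (chain C).
    - apply: compact_closedI => //; apply: open_closedC; exact: open_interior.
    - by exists V; split => // x.
    - by move=> i [ni _]; apply: chain_closed.
    - move=> i [ni iV]; apply: contrapT => /set0P/negP/negPn/eqP e0; apply: no.
      exists i; split=> // x cx; apply: interior_subset; apply: contrapT => nx.
      have : (C `&` ~` (N A `|` N B)^° `&` chain C i) x.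
        by split=> //; split=> //; apply: (chain_sub C1 cx).
      by rewrite e0.
    - move=> i j [ni iV] [nj jV]; exists (i `&` j).
        by split; [exact: filterI|move=> x [/iV]].
      by move=> x cx; split; apply: chain_mono cx => y [].
    case: Cx => Cx; apply; apply: QN => W nW.
    have /chain_mono : W `&` V `<=` W by move=> y [].
    by apply; apply: xF; split; [exact: filterI|move=> y []].
  have cNA : chain C V1 `<=` N A.
    suff : chain C V1 `<=` chain C V1 `&` N A by move=> sub x /sub[].
    apply: smallest_sub; last by move=> _ ->; split; [exact: chain1|exact: sN].
    move=> x y [cx Nx] Cy Vyx; have cy := chain_step cx Cy Vyx.
    by split=> //; case: (sV1 _ cy) => // /(sepN _ _ Nx (V1V _ Vyx)).
  apply/seteqP; split=> // b Bb.
  have Qb : Q b by rewrite eQ; right.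
  apply: (sepN b b); last exact: sN.
    by apply: cNA; apply: Qb.
  by rewrite mulgV; apply: nbhs1.
(* A relatively clopen part of [Q] and its complement are both closed; [sep] empties the one missing
   1. *)
move=> B [b Bb] [O oO BO] [F cF BF].
have cB : closed B by rewrite BF; apply: closedI.
have cQB : closed (Q `\` B).
  have -> : Q `\` B = Q `&` ~` O.
    rewrite BO; apply/seteqP; split=> x [Qx]; last by move=> nO; split=> // -[].
    by move=> nQO; split=> // Ox; apply: nQO.
  by apply: closedI => //; apply: open_closedC.
have BQ : B `<=` Q by rewrite BO => x [].
have [B1|nB1] := pselect (B 1); last first.
  have : B = set0; last by move=> e; move: Bb; rewrite e.
  apply: (sep (Q `\` B)) => //; first by rewrite setDKI.
  by rewrite setUC setDUK.
have : Q `\` B = set0.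
  by apply: (sep B) => //; [apply/seteqP; split=> // x [Bx []]|rewrite setDUK].
by move=> e; apply/seteqP; split=> // x Qx; apply: contrapT => nBx; rewrite -[False]/(set0 x) -e.
Qed.

Hypotheses (hG : hausdorff_space G) (lG : locally_compact [set: G])
  (tG : totally_disconnected [set: G]).

Lemma compact_nbhs W : nbhs (1 : G) W ->
  exists C, [/\ nbhs (1 : G) C, compact C, closed C & C `<=` W].
Proof.
move=> nW; have [/= C nC [coC cC]] := lG (x := 1) I.
have [V nV VW] := nbhs_mul nW; pose V' := V `&` [set x | V x^-1].
have nV' : nbhs (1 : G) V' by apply: filterI => //; apply: nbhs_inv.
exists (C `&` closure V'); split.
- apply: filterI; last by apply: filterS nV'; apply: subset_closure.
  have : within [set: G] (nbhs (1 : G)) C by [].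
  by rewrite /within /=; apply: filterS => x; apply.
- by apply: compact_closedI => //; apply: closed_closure.
- by apply: closedI => //; apply: closed_closure.
move=> x [_ /(_ _ (nbhs_mulrV x nV'))] [z [[Vz _] [Vxz _]]].
by have := VW _ _ Vxz Vz; rewrite mulgVK.
Qed.

(** A [chain C V] inside the interior of [C] is open, being closed under small steps. If no [V]
    achieved this, compactness would give a point of [C] outside its interior that all chains reach;
    it lies in the connected component of 1, so it is 1, which is interior. *)
Lemma compact_open_nbhs W : nbhs (1 : G) W ->
  exists C, [/\ open C, compact C, C 1 & C `<=` W].
Proof.
move=> /compact_nbhs[C [nC coC cC CW]].
have C1 := nbhs1 nC.
suff [V nV VC] : exists2 V, nbhs (1 : G) V & chain C V `<=` C^°.
  exists (chain C V); split.
  - rewrite openE => x cx; have := VC x cx; rewrite /interior /= => nCx.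
    have : nbhs x [set z | V (z * x^-1)].
      by apply/nbhs_mulr; apply: filterS nV => z Vz /=; rewrite mulgK.
    by apply: filterS2 nCx => z; apply: chain_step.
  - by apply: subclosed_compact coC (chain_sub C1); apply: chain_closed.
  - exact: chain1.
  - by apply: subset_trans CW; apply: chain_sub.
apply: contrapT => no.
have [|||||x [Cx bx] xF] := @compact_directed G (C `&` ~` C^°) (set G)
  [set V | nbhs (1 : G) V] (chain C).
- by apply: compact_closedI => //; apply: open_closedC; exact: open_interior.
- by exists setT; exact: filterT.
- by move=> i ni; apply: chain_closed.
- move=> i ni; apply: contrapT => /set0P/negP/negPn/eqP e0; apply: no.
  exists i => // x cx; apply: contrapT => nx.
  have : (C `&` ~` C^° `&` chain C i) x.
    by split=> //; split=> //; apply: (chain_sub C1 cx).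
  by rewrite e0.
- move=> i j ni nj; exists (i `&` j); first exact: filterI.
  by move=> x cx; split; apply: chain_mono cx => y [].
have : connected_component [set: G] 1 x.
  exists (\bigcap_(V in nbhs (1 : G)) chain C V) => //.
  by split => // [V _|]; [exact: chain1|exact: chain_connected].
by rewrite tG // => x1; apply: bx; rewrite x1.
Qed.

(** [U] is the stabiliser, under right translation, of a compact open neighbourhood [C] of 1; it is
    open by compactness of [C], and contained in [C] because 1 is in [C]. *)
Lemma van_dantzig W : nbhs (1 : G) W ->
  exists U, [/\ is_subgroup U, open U, compact U & U `<=` W].
Proof.
move=> /compact_open_nbhs[C [oC coC C1 CW]].
pose U := [set g : G | forall y, C y -> C (y * g) /\ C (y * g^-1)].
have sU : is_subgroup U.
  split; first by move=> y Cy; rewrite invg1 mulg1.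
  - move=> g h Ug Uh y Cy; rewrite invgM !mulgA.
    by split; [apply Uh; apply Ug|apply Ug; apply Uh].
  - by move=> g Ug y Cy; rewrite invgK and_comm; apply: Ug.
have nU : nbhs (1 : G) U.
  have /compact_near_coveringP nC := coC.
  apply: (nC _ _ (fun g y => C (y * g) /\ C (y * g^-1))) => y Cy.
  have nCy : nbhs y C by apply: open_nbhs_nbhs.
  apply: filterI.
    have : (fun p : G * G => p.1 * p.2) @ (y, 1 : G) --> y * 1.
      by apply: mul_cvg; [exact: cvg_fst|exact: cvg_snd].
    by rewrite mulg1 => /(_ _ nCy).
  have : (fun p : G * G => p.1 * p.2^-1) @ (y, 1 : G) --> y * 1^-1.
    by apply: mul_cvg; [exact: cvg_fst|apply: inv_cvg; exact: cvg_snd].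
  by rewrite invg1 mulg1 => /(_ _ nCy).
have UC : U `<=` C by move=> g /(_ 1 C1) []; rewrite mul1g.
exists U; split=> //; first exact: subgroup_open.
  by apply: subclosed_compact coC UC; apply: subgroup_closed.
exact: subset_trans CW.
Qed.

End VanDantzig.

(** * Pro-C groups through finite quotients *)

Lemma multiplicative1 (gT hT : groupType) (f : {multiplicative gT -> hT}) : f 1 = 1.
Proof. by apply: (mulgI (f 1)); rewrite -gmulfM !mulg1. Qed.

Section Pro.
Variable G : topologicalGroupType.
Variable P : finclass.
Implicit Types (A B C H K N U V W : set G).

Definition relopen H N := exists2 O, nbhs (1 : G) O & H `&` O `<=` N.

Lemma relopen_closed H N : is_subgroup H -> closed H -> is_subgroup N -> N `<=` H ->
  relopen H N -> closed N.
Proof.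
move=> sH cH sN NH [O nO HO] y cly.
have Hy : H y by apply: cH => B /cly[z [/NH Hz Bz]]; exists z.
have [z [Nz Oyz]] := cly _ (nbhs_mulrV y nO).
rewrite -(mulgVK z y); apply: subgroupM => //; apply: HO; split=> //.
by apply: subgroupM => //; apply: subgroupV => //; apply: NH.
Qed.

Lemma relopen_fin_quot H N : is_subgroup H -> compact H -> is_subgroup N -> N `<=` H ->
  (forall x y, N x -> H y -> N (x ^ y)) -> relopen H N -> fin_quot H N.
Proof.
move=> sH cH sN NH nN [O nO HO].
have [s cov] := compact_finite_cosets cH nO.
apply: (fin_quot_cosets (s := s)) => // x Hx.
have [h [hs Hh Oxh]] := cov _ Hx; exists h; split=> //.
by apply: HO; split=> //; apply: subgroupM => //; apply: subgroupV.
Qed.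

(** A working form of the pro-C property, through small relatively open kernels. For compact
    subgroups of Hausdorff groups, [pro_residually] and [residually_pro] translate between it and
    inverse limits. *)
Definition residually H := is_subgroup H /\ forall W, nbhs (1 : G) W ->
  exists N, [/\ N `<=` W, relopen H N & quot_in P H N].

Lemma residuallyS H K : is_subgroup K -> K `<=` H -> residually H -> residually K.
Proof.
move=> sK KH [sH pH]; split=> // W /pH[N [NW [O nO HO] qN]].
exists (K `&` N); split; last exact: quot_inS qN.
  by move=> x [_ /NW].
by exists O => // x [Kx Ox]; split=> //; apply: HO; split=> //; apply: KH.
Qed.

Variable C : finGroupType -> Prop.

(** The kernels of the coordinates on the limit are relatively open and directed, with trivial
    intersection, so by compactness one of them lies in [W]. *)
Lemma pro_residually H : hausdorff_space G -> compact H ->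
  (forall gT, C gT -> P gT [set: gT]%G) -> pro C H -> residually H.
Proof.
move=> hG coH CP [sH [S [CS [f [g [[fH gH] [fK gK] mf cf cg]]]]]].
have cH := compact_closed hG coH.
split=> // W nW.
pose F i x : obj i := f x i.
have mF i : morph_on H (F i) by move=> x y Hx Hy; apply: mf.
have sF i : is_subgroup (ker_on H (F i)) by apply: ker_on_subgroup.
have F1 i : F i 1 = 1 by apply: morph_on1 (mF i).
have FH i : ker_on H (F i) `<=` H by move=> x [].
have rF i : relopen H (ker_on H (F i)).
  have /subspace_continuousP/(_ _ (subgroup1 sH)) := cf.
  move/cvg_sup/(_ i) => cfi.
  have nFi : within H (nbhs (1 : G)) [set x | F i x = 1].
    apply: (cfi [set t | (t i : obj i) = 1]).
    exists [set t | (t i : obj i) = 1]; split=> //.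
    by exists [set 1] => //; apply: discrete_open.
  exists [set x | H x -> F i x = 1]; first exact: nFi.
  by move=> x [Hx /(_ Hx)].
apply: contrapT => no.
have [|||||x [Hx nWx] xF] := @compact_directed G (H `&` ~` W^°) (idx S)
   [set: idx S] (fun i => ker_on H (F i)).
- by apply: compact_closedI => //; apply: open_closedC; exact: open_interior.
- by have [i] := idx_inhabited S; exists i.
- by move=> i _; apply: (relopen_closed sH).
- move=> i _; apply: contrapT => /set0P/negP/negPn/eqP e0; apply: no.
  exists (ker_on H (F i)); split=> //.
    move=> x xF; apply: interior_subset; apply: contrapT => nWx.
    have : (H `&` ~` W^° `&` ker_on H (F i)) x by split=> //; split=> //; apply: FH xF.
    by rewrite e0.
  exists (obj i), [set: obj i]%G, (F i); split=> //; first exact: CP.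
  by move=> x _; rewrite finset.in_setT.
- move=> i j _ _; have [k [ik jk]] := idx_directed i j; exists k => // x [Hx Fx].
  have lim := fH _ Hx.
  split; split=> //; first by rewrite -(multiplicative1 (trans ik)) -Fx /F lim.
  by rewrite -(multiplicative1 (trans jk)) -Fx /F lim.
have x1 : x = 1.
  rewrite -(fK x) ?inE // -(fK 1) ?inE; last exact: subgroup1.
  congr g; apply: functional_extensionality_dep => i.
  by have [_] := xF i I; rewrite -(F1 i).
by apply: nWx; rewrite x1; apply: nbhs_singleton; apply: nbhs_interior.
Qed.

End Pro.

Section Surj.
Variables (G : groupType) (P : finclass).
Implicit Types (H K N : set G).

(** Corestricting to the image makes the transition maps between finite quotients uniquely
    determined and everywhere defined. *)
Lemma quot_in_surj H N : is_subgroup H -> quot_in P H N ->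
  exists (gT : finGroupType) (f : G -> gT), [/\ P gT [set: gT]%G, morph_on H f,
    N = ker_on H f & forall y, exists2 x, H x & f x = y].
Proof.
move=> sH [gT [A [f [PA fA mf ->]]]].
have [B BE] := image_group sH mf.
have BA : B \subset A by apply/fintype.subsetP => _ /BE[x Hx <-]; apply: fA.
have fB x : H x -> f x \in B by move=> Hx; apply/BE; exists x.
exists (subg_of B), (fun x => subg B (f x)); split.
- have := @fc_morphim P _ _ _ (subg_morphism B) (fc_sub BA PA).
  by congr (P _ _); apply: val_inj; rewrite /= im_subg.
- by move=> x y Hx Hy; rewrite mf // subgM // fB.
- apply/seteqP; split=> x [Hx fx]; split=> //; first by rewrite fx (morph1 (subg_morphism B)).
  by rewrite -(subgK (f x) (fB x Hx)) fx.
- move=> y; have /BE[x Hx fx] := subgP y.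
  by exists x => //; rewrite fx sgvalK.
Qed.

Lemma morph_factor H (gT hT : finGroupType) (f : G -> gT) (t : G -> hT) :
  is_subgroup H -> morph_on H f -> morph_on H t -> ker_on H f `<=` ker_on H t ->
  (forall y, exists2 x, H x & f x = y) ->
  exists g : {multiplicative gT -> hT}, forall x, H x -> g (f x) = t x.
Proof.
move=> sH mf mt sub surj.
have surj' y : y \in [set: gT]%G <-> exists2 x, H x & f x = y.
  by split=> // _; rewrite finset.in_setT.
have [g gE] := morph_on_factor sH mf mt sub surj'.
pose h : gT -> hT := fun x => g x.
have mg : {morph h : x y / x * y} by move=> a b; rewrite /h morphM ?finset.in_setT.
pose gm : {multiplicative gT -> hT} := HB.pack h (isMultiplicative.Build _ _ h mg).
by exists gm.
Qed.
End Surj.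

(** * Compact groups as inverse limits of their finite quotients *)

Section LproPro.
Variable G : topologicalGroupType.
Variable P : finclass.
Implicit Types (A B H K N U V W : set G).

Lemma fiber_closed H (gT : groupType) (f : G -> gT) c : is_subgroup H -> closed H ->
  morph_on H f -> relopen H (ker_on H f) -> closed [set x | H x /\ f x = c].
Proof.
move=> sH cH mf [O nO HO] y cly.
have Hy : H y by apply: cH => B /cly[z [[Hz _] Bz]]; exists z.
split=> //; have [z [[Hz <-] Oyz]] := cly _ (nbhs_mulrV y nO).
have Hyz : H (y * z^-1) by apply: subgroupM => //; apply: subgroupV.
have [|_ fyz] := HO (y * z^-1); first by split.
by rewrite -{1}(mulgVK z y) mf // fyz mul1g.
Qed.

Lemma relopenI H M N : relopen H M -> relopen H N -> relopen H (M `&` N).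
Proof.
move=> [O nO HO] [O' nO' HO']; exists (O `&` O'); first exact: filterI.
by move=> x [Hx [Ox O'x]]; split; [apply: HO|apply: HO'].
Qed.

Variable H : set G.
Hypotheses (hG : hausdorff_space G) (cH : compact H) (lH : residually P H).

Let sH : is_subgroup H. Proof. by case: lH. Qed.

Definition open_quot := {N : set G | quot_in P H N /\ relopen H N}.
Implicit Types i j k : open_quot.

Let qT i : finGroupType := projT1 (cid (quot_in_surj sH (svalP i).1)).
Let qf i : G -> qT i := projT1 (cid (projT2 (cid (quot_in_surj sH (svalP i).1)))).
Let qP i : [/\ P _ [set: qT i]%G, morph_on H (qf i),
    sval i = ker_on H (qf i) & forall y, exists2 x, H x & qf i x = y].
Proof. exact: (projT2 (cid (projT2 (cid (quot_in_surj sH (svalP i).1))))). Qed.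

Let qle i j := sval j `<=` sval i.

Let qtrans_ex i j (h : qle i j) :
  exists g : {multiplicative qT j -> qT i}, forall x, H x -> g (qf j x) = qf i x.
Proof.
have [_ mi ei _] := qP i; have [_ mj ej sj] := qP j.
by apply: morph_factor => //; rewrite -ei -ej.
Qed.

Let qtrans i j (h : qle i j) : {multiplicative qT j -> qT i} :=
  projT1 (cid (qtrans_ex h)).
Let qtransE i j (h : qle i j) x : H x -> qtrans h (qf j x) = qf i x.
Proof. exact: (projT2 (cid (qtrans_ex h))). Qed.

Let qinhab : inhabited open_quot.
Proof.
have [_ /(_ setT filterT)[N [_ rN qN]]] := lH.
by constructor; exists N.
Qed.

Let qdir i j : exists k, qle i k /\ qle j k.
Proof.
have [qi ri] := svalP i; have [qj rj] := svalP j.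
have qij : quot_in P H (sval i `&` sval j) /\ relopen H (sval i `&` sval j).
  by split; [exact: quot_inI|exact: relopenI].
by exists (exist (fun N => quot_in P H N /\ relopen H N) _ qij); split=> x [].
Qed.

Let qtrans_id i (h : qle i i) x : qtrans h x = x.
Proof. by have [_ _ _ /(_ x)[y Hy <-]] := qP i; rewrite qtransE. Qed.

Let qtrans_comp i j k (hij : qle i j) (hjk : qle j k) (hik : qle i k) x :
  qtrans hij (qtrans hjk x) = qtrans hik x.
Proof. by have [_ _ _ /(_ x)[y Hy <-]] := qP k; rewrite !qtransE. Qed.

Let qsys : inverse_system :=
  @InverseSystem open_quot qle qinhab (fun=> @subset_refl _ _)
    (fun i j k hij hjk => subset_trans hjk hij) qdir qT qtrans qtrans_id qtrans_comp.

(** [H] is the limit of all its open quotients in the class, ordered by reverse inclusion of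
    kernels. The canonical map is injective since kernels are arbitrarily small, and onto the limit
    since the fibres over a thread are closed, non-empty and directed in the compact [H]. The
    inverse picks the unique point of these fibres; its continuity also comes from small kernels. *)
Lemma residually_pro (C : finGroupType -> Prop) :
  (forall gT : finGroupType, P gT [set: gT]%G -> C gT) -> pro C H.
Proof.
move=> PC; split=> //; exists qsys; split.
  by move=> i; apply: PC; case: (qP i).
have clH := compact_closed hG cH.
pose f x : inv_prod qsys := fun i => qf i x.
pose S (t : inv_prod qsys) := [set x | H x /\ forall i, qf i x = t i].
pose g t := xget 1 (S t).
have fH x : H x -> inv_limit qsys (f x).
  by move=> Hx i j h; rewrite /f /= qtransE.
have small W : nbhs (1 : G) W -> exists i, sval i `<=` W.
  have [_ /[apply] -[N [NW rN qN]]] := lH.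
  by exists (exist (fun N => quot_in P H N /\ relopen H N) _ (conj qN rN)).
have ker1 x : H x -> (forall i, qf i x = 1) -> x = 1.
  move=> Hx x1; apply: contrapT => xn1.
  have nW : nbhs (1 : G) (~` [set x]).
    apply: open_nbhs_nbhs; split; last by move=> /= e; apply: xn1.
    by apply: closed_openC; apply/accessible_closed_set1/hausdorff_accessible.
  have [i iW] := small _ nW; apply: (iW x) => //.
  by have [_ _ ei _] := qP i; rewrite ei; split => //; apply: x1.
have uniqS t x y : S t x -> S t y -> x = y.
  move=> [Hx ex] [Hy ey]; have Hy' := subgroupV sH Hy.
  apply: (mulIg y^-1); rewrite mulgV; apply: ker1; first exact: subgroupM.
  move=> i; have [_ mi _ _] := qP i.
  by rewrite mi // (morph_onV sH mi) // ex ey mulgV.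
have exS t : inv_limit qsys t -> S t !=set0.
  move=> lt.
  have [|||||x Hx xF] := @compact_directed G H open_quot setT
     (fun i => [set x | H x /\ qf i x = t i]).
  - exact: cH.
  - by have [i] := qinhab; exists i.
  - move=> i _; have [_ mi ei _] := qP i; apply: fiber_closed => //.
    by rewrite -ei; case: (svalP i).
  - by move=> i _; have [_ _ _ /(_ (t i))[x Hx fx]] := qP i; exists x.
  - move=> i j _ _; have [k [ik jk]] := qdir i j; exists k => // x [Hx fx].
    by split; split=> //; rewrite -(lt _ _ ik, lt _ _ jk) /= -fx qtransE.
  by exists x; split=> // i; case: (xF i).
have gS t : inv_limit qsys t -> S t (g t) by move=> /exS; apply: xgetPex.
exists f, g; split.
- by split=> [x Hx|t /gS[]] //; apply: fH.
- split=> [x|t]; rewrite inE => h.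
    by apply: (uniqS (f x)); [exact/gS/fH|split].
  by apply: functional_extensionality_dep => i; case: (gS t h) => _; apply.
- by move=> x y i Hx Hy; have [_ mi _ _] := qP i; apply: mi.
- apply/subspace_continuousP => x Hx; apply/cvg_sup => i U [V [[W] oW <-] Wx VU].
  have [_ mi ei _] := qP i; have [_ [O nO HO]] := svalP i.
  have nx : nbhs x [set y | O (y * x^-1)].
    by apply/nbhs_mulr; apply: filterS nO => y Oy /=; rewrite mulgK.
  rewrite /within /=; apply: filterS nx => y Oyx Hy.
  have Hyx : H (y * x^-1) by apply: subgroupM => //; apply: subgroupV.
  have [_ fyx] : ker_on H (qf i) (y * x^-1) by rewrite -ei; apply: HO; split.
  have e : qf i y = qf i x by rewrite -(mulgVK x y) mi // fyx mul1g.
  have Wy : W (f y i) by rewrite /f e.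
  exact: (VU (f y) Wy).
- apply/subspace_continuousP => t lt W nW.
  have [Hx xt] := gS t lt; set x := g t in nW Hx xt.
  have [i iW] := small _ ((nbhs_mulr x W).1 nW).
  have [_ mi ei _] := qP i.
  have nt : nbhs t [set t' | (t' i : qT i) = t i].
    have /cvg_sup/(_ i) ti : nbhs t --> t by apply: cvg_id.
    apply: ti; exists [set t' | (t' i : qT i) = t i]; split=> //.
    by exists [set t i] => //; apply: discrete_open.
  rewrite /within /=; apply: filterS nt => t' /= e lt'.
  have [Hy yt] := gS t' lt'.
  suff Wg : W (g t') by exact: Wg.
  rewrite -(mulgVK x (g t')).
  apply: iW; rewrite ei; split; first by apply: subgroupM => //; apply: subgroupV.
  rewrite mi ?(morph_onV sH mi) ?yt ?xt ?e ?mulgV //.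
  exact: subgroupV.
Qed.

End LproPro.

(** * Generation and closure *)

Section Gen.
Variable G : groupType.
Implicit Types A B H : set G.

Lemma gen_subgroup A : is_subgroup (gen A).
Proof.
split.
- by move=> B [[]].
- by move=> x y gx gy B [sB AB]; apply: (subgroupM sB); [apply: gx|apply: gy].
- by move=> x gx B [sB AB]; apply: (subgroupV sB); apply: gx.
Qed.

Lemma sub_gen A : A `<=` gen A.
Proof. exact: sub_gen_smallest. Qed.

Lemma gen_sub A H : is_subgroup H -> A `<=` H -> gen A `<=` H.
Proof. exact: smallest_sub. Qed.

Lemma gen_conj A (g : G) : (forall x, A x -> gen A (x ^ g)) ->
  forall x, gen A x -> gen A (x ^ g).
Proof.
move=> Ag; have sA := gen_subgroup A; apply: gen_sub => //; split.
- by rewrite conj1g; exact: subgroup1.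
- by move=> x y; rewrite conjMg; apply: subgroupM.
- by move=> x; rewrite conjVg; apply: subgroupV.
Qed.

Lemma gen_finite A x : gen A x ->
  exists2 s : seq G, (forall y, y \in s -> A y) & gen [set y | y \in s] x.
Proof.
pose H := [set x | exists2 s : seq G, (forall y, y \in s -> A y) &
                                     gen [set y | y \in s] x].
suff : gen A `<=` H by apply.
have mono (s t : seq G) : {subset s <= t} ->
    gen [set y | y \in s] `<=` gen [set y | y \in t].
  by move=> st; apply: gen_sub; [exact: gen_subgroup|move=> y /st yt; exact: sub_gen].
apply: gen_sub; first split.
- by exists [::] => //; exact: (subgroup1 (gen_subgroup _)).
- move=> a b [s sA sa] [t tA tb]; exists (s ++ t).
    by move=> y; rewrite mem_cat => /orP[/sA|/tA].
  apply: (subgroupM (gen_subgroup _)).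
    by apply: mono sa => y; rewrite mem_cat => ->.
  by apply: mono tb => y; rewrite mem_cat orbC => ->.
- move=> a [s sA sa]; exists s => //; exact: (subgroupV (gen_subgroup _)).
- move=> a Aa; exists [:: a]; first by move=> y; rewrite inE => /eqP ->.
  by apply: sub_gen; rewrite /= inE.
Qed.

Lemma normaliserP H (g x : G) : normaliser H g -> (H (x ^ g) <-> H x).
Proof.
rewrite /normaliser /= => e; split=> Hx; last by rewrite -e; exists x.
by move: Hx; rewrite -{1}e => -[y Hy /conjg_inj <-].
Qed.

(** Asking for [g] and its inverse together makes the stable elements a subgroup. *)
Definition stable H (g : G) := forall x, H x -> H (x ^ g) /\ H (x ^ g^-1).

Lemma stable_subgroup H : is_subgroup (stable H).
Proof.
split.
- by move=> x Hx; rewrite invg1 conjg1.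
- move=> g h sg sh x Hx; rewrite invgM !conjgM; split.
    by case: (sg _ Hx) => /sh[].
  by case: (sh _ Hx) => _ /sg[].
- by move=> g sg x Hx; rewrite invgK; split; apply sg.
Qed.

Lemma stable_gen H A : gen A = [set: G] -> A `<=` stable H ->
  forall x g, H x -> H (x ^ g).
Proof.
move=> gA AH x g Hx; have : gen A g by rewrite gA.
by move/(gen_sub (@stable_subgroup H) AH) => /(_ x Hx)[].
Qed.

Lemma conj_inv_normal H : is_subgroup H -> (forall x g, H x -> H (x ^ g)) ->
  is_normal H.
Proof.
move=> sH cH; split=> //; apply/seteqP; split=> // g _; apply/seteqP; split.
  by move=> _ [x Hx <-]; apply: cH.
by move=> x Hx; exists (x ^ g^-1); [exact: cH|exact: conjgKV].
Qed.

End Gen.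

Section TopGen.
Variable G : topologicalGroupType.
Implicit Types (A B H K U V W : set G).

Lemma closureP H x : closure H x -> forall W, nbhs (1 : G) W ->
  exists2 z, H z & W (x * z^-1).
Proof. by move=> cl W nW; have [z [Hz Wz]] := cl _ (nbhs_mulrV x nW); exists z. Qed.

Lemma closure_subgroup H : is_subgroup H -> is_subgroup (closure H).
Proof.
move=> sH; split; first by apply: subset_closure; exact: subgroup1.
- move=> x y cx cy W; have : (fun p : G * G => p.1 * p.2) @ (x, y) --> x * y.
    exact: (@mulg_continuous G (x, y)).
  move=> /[apply] -[[A B] /= [nA nB] sub].
  have [a [Ha Aa]] := cx _ nA; have [b [Hb Bb]] := cy _ nB.
  by exists (a * b); split; [exact: subgroupM|exact: (sub (a, b))].
- move=> x cx W /invg_continuous /cx[a [Ha Wa]].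
  by exists a^-1; split=> //; apply: subgroupV.
Qed.

Lemma closure_conj H (g : G) : (forall x, H x -> H (x ^ g)) ->
  forall x, closure H x -> closure H (x ^ g).
Proof.
move=> Hg x cx W /conj_continuous /cx[a [Ha Wa]].
by exists (a ^ g); split=> //; apply: Hg.
Qed.

(** A compact generating set is covered by finitely many cosets of [U]. By density their
    representatives may be replaced, modulo [U], by elements of [gen A], each involving finitely
    many elements of [A]. *)
Lemma dense_gen A U : compactly_generated G -> is_subgroup U -> open U ->
    closure (gen A) = [set: G] ->
  exists2 s : seq G, (forall x, x \in s -> A x) & gen (U `|` [set x | x \in s]) = [set: G].
Proof.
move=> [K cK gK] sU oU dA; have nU := open_nbhs1 sU oU.
have [s sK] := compact_finite_cosets cK nU.
have [t tA ts] : exists2 t : seq G, (forall x, x \in t -> A x) &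
    forall h, h \in s -> exists2 n, gen [set x | x \in t] n & U (h * n^-1).
  elim: s {sK} => [|h s [t tA ts]]; first by exists [::].
  have [|n An Un] := @closureP (gen A) h _ U nU; first by rewrite dA.
  have [t' t'A t'n] := gen_finite An; exists (t' ++ t).
    by move=> x; rewrite mem_cat => /orP[/t'A|/tA].
  move=> k; rewrite inE => /orP[/eqP ->|/ts[m tm Um]].
    exists n => //; apply: gen_sub t'n; first exact: gen_subgroup.
    by move=> x xt; apply: sub_gen; rewrite /= mem_cat xt.
  exists m => //; apply: gen_sub tm; first exact: gen_subgroup.
  by move=> x xt; apply: sub_gen; rewrite /= mem_cat xt orbT.
exists t => //; apply/seteqP; split=> // x _; have : gen K x by rewrite gK.
apply: gen_sub => [|y /sK[h [/ts[n tn Un] _ Uy]]]; first exact: gen_subgroup.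
set E := gen _; have sE : is_subgroup E by exact: gen_subgroup.
have UE z : U z -> E z by move=> Uz; apply: sub_gen; left.
rewrite -(mulgVK h y); apply: subgroupM (UE _ Uy) _ => //.
rewrite -(mulgVK n h); apply: subgroupM (UE _ Un) _ => //.
by apply: gen_sub tn => // z zt; apply: sub_gen; right.
Qed.

(** The intersection of the [U]-conjugates of [H], cut down to [U], is open by [tube]. *)
Lemma normal_core U W : is_subgroup U -> compact U -> open U ->
    (exists H, [/\ is_subgroup H, open H & H `<=` W]) ->
  exists V, [/\ is_subgroup V, open V, V `<=` U, V `<=` W &
    forall x u, V x -> U u -> V (x ^ u)].
Proof.
move=> sU cU oU [H [sH oH HW]].
pose V := U `&` [set x | forall u, U u -> H (x ^ u)].
have sV : is_subgroup V.
  split.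
  - by split; [exact: subgroup1|move=> u _; rewrite conj1g; exact: subgroup1].
  - move=> x y [Ux Hx] [Uy Hy]; split; first exact: subgroupM.
    by move=> u Uu; rewrite conjMg; apply: subgroupM; [|exact: Hx|exact: Hy].
  - move=> x [Ux Hx]; split; first exact: subgroupV.
    by move=> u Uu; rewrite conjVg; apply: subgroupV => //; apply: Hx.
exists V; split=> //.
- apply: subgroup_open => //; apply: filterI; first exact: open_nbhs1.
  by apply: tube => //; apply: open_nbhs1.
- by move=> x [].
- by move=> x [_ /(_ 1 (subgroup1 sU))]; rewrite conjg1 => /HW.
- move=> x u [Ux Hx] Uu; split; first exact: subgroupJ.
  by move=> v Uv; rewrite -conjgM; apply: Hx; apply: subgroupM.
Qed.

End TopGen.

(** * Local structure of groups in the class S *)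

Section ClassS.
Variable G : topologicalGroupType.
Hypothesis HG : class_S G.
Implicit Types (A B H K M U V W : set G).

Let hG := class_S_hausdorff HG.

Lemma nontrivial_ex H : is_subgroup H -> H <> [set 1] -> exists2 x, H x & x <> 1.
Proof.
move=> sH nH; apply: contrapT => no; apply: nH; apply/seteqP; split=> x.
  by move=> Hx; apply: contrapT => x1; apply: no; exists x.
by move=> ->; exact: subgroup1.
Qed.

Lemma setC1_nbhs (x : G) : x <> 1 -> nbhs (1 : G) (~` [set x]).
Proof.
move=> x1; apply: open_nbhs_nbhs; split; last by move=> /= e; apply: x1.
by apply: closed_openC; apply/accessible_closed_set1/hausdorff_accessible.
Qed.

Lemma not_nbhs1 : ~ nbhs (1 : G) [set 1].
Proof.
move=> n1; apply: (class_S_nondiscrete HG) => A; rewrite openE => x Ax.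
by apply/nbhs_mulr; apply: filterS n1 => y -> /=; rewrite mul1g.
Qed.

Lemma proper_nbhs : exists2 W, nbhs (1 : G) W & W <> [set: G].
Proof.
have [nG _] := class_S_topologically_simple HG.
have [|x _ x1] := @nontrivial_ex [set: G] _ nG; first by [].
exists (~` [set x]); first exact: setC1_nbhs.
by move=> e; have : [set: G] x by []; rewrite -e; apply.
Qed.

Lemma compact_open_subgroup W : nbhs (1 : G) W ->
  exists U, [/\ is_subgroup U, open U, compact U & U `<=` W].
Proof.
apply: van_dantzig => //; first exact: class_S_locally_compact.
exact: class_S_totally_disconnected.
Qed.

Lemma proper_compact_open : exists U, [/\ is_subgroup U, open U, compact U & U <> [set: G]].
Proof.
have [W nW WT] := proper_nbhs; have [U [sU oU cU UW]] := compact_open_subgroup nW.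
by exists U; split=> // e; apply: WT; apply/seteqP; split=> //; rewrite -e.
Qed.

Lemma normal_dense M : is_subgroup M -> M <> [set 1] ->
  (forall x g, M x -> M (x ^ g)) -> closure M = [set: G].
Proof.
move=> sM nM cM; have [_ simp] := class_S_topologically_simple HG.
have [||e|//] := simp (closure M).
- apply: conj_inv_normal; first exact: closure_subgroup.
  by move=> x g; apply: closure_conj => y; apply: cM.
- exact: closed_closure.
case: nM; apply/seteqP; split=> [x Mx|_ ->]; last exact: subgroup1.
by rewrite -e; apply: subset_closure.
Qed.

Lemma normal_in_proper M U : is_subgroup M -> (forall x g, M x -> M (x ^ g)) ->
  closed U -> U <> [set: G] -> M `<=` U -> M = [set 1].
Proof.
move=> sM cM cU UT MU; apply: contrapT => nM; apply: UT.
apply/seteqP; split=> // x _; have := normal_dense sM nM cM => e.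
rewrite (iffLR (closure_id _) cU); apply: (closure_subset MU).
by rewrite e.
Qed.

End ClassS.

(** * Stabilisers of balls in the Cayley-Abels graph *)

Section Engine.
Variable G : topologicalGroupType.
Hypothesis HG : class_S G.
Implicit Types (A B H K M V W X : set G).

Let hG := class_S_hausdorff HG.

(* As [D] is symmetric it is bi-invariant under [U]; the words of length [n] in [D]
   represent the vertices at distance at most [n] from the base point of the
   Cayley-Abels graph on [G / U], and [fixb n] is their pointwise stabiliser. *)
Variables U D : set G.
Hypotheses (sU : is_subgroup U) (oU : open U) (cU : compact U) (UT : U <> [set: G]).
Hypotheses (cD : compact D) (D1 : D 1) (UD : forall u d, U u -> D d -> D (u * d))
  (DV : forall d, D d -> D d^-1) (gD : gen D = [set: G]).

Fixpoint words n : set G :=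
  if n is n.+1 then [set x | exists d e, [/\ D d, words n e & x = d * e]] else U.

Fixpoint fixb n : set G :=
  if n is n.+1 then [set x | forall d, D d -> fixb n (x ^ d)] else U.

Lemma fixb_subgroup n : is_subgroup (fixb n).
Proof.
elim: n => // n sn; split=> /=.
- by move=> d _; rewrite conj1g; exact: subgroup1.
- by move=> x y Kx Ky d Dd; rewrite conjMg; apply: subgroupM; [|exact: Kx|exact: Ky].
- by move=> x Kx d Dd; rewrite conjVg; apply: subgroupV => //; apply: Kx.
Qed.

Lemma fixb_nbhs n : nbhs (1 : G) (fixb n).
Proof. by elim: n => [|n nn]; [exact: open_nbhs1|apply: tube]. Qed.

Lemma fixb_open n : open (fixb n).
Proof. exact: subgroup_open (fixb_subgroup n) (fixb_nbhs n). Qed.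

Lemma fixb_closed n : closed (fixb n).
Proof. exact: subgroup_closed (fixb_subgroup n) (fixb_nbhs n). Qed.

Lemma fixbS n : fixb n.+1 `<=` fixb n.
Proof. by move=> x /(_ 1 D1); rewrite conjg1. Qed.

Lemma fixb_le m n : (m <= n)%N -> fixb n `<=` fixb m.
Proof.
move/subnK <-; elim: (n - m)%N => // k IH x.
by rewrite addSn => /fixbS /IH.
Qed.

Lemma fixbU n : fixb n `<=` U. Proof. exact: (@fixb_le 0). Qed.

Lemma fixb_compact n : compact (fixb n).
Proof. exact: subclosed_compact (@fixb_closed n) cU (@fixbU n). Qed.

Lemma fixbJ n x u : fixb n x -> U u -> fixb n (x ^ u).
Proof.
case: n => [|n] Kx Uu; first exact: subgroupJ.
by move=> d Dd; rewrite -conjgM; apply: Kx; apply: UD.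
Qed.

(** Fixing the ball of radius [m + n] means fixing the ball of radius [n] around every point at
    distance at most [m]. *)
Lemma fixb_add m n x : fixb (m + n) x <-> forall g, words m g -> fixb n (x ^ g).
Proof.
elim: m x => [|m IH] x.
  split=> [Kx u|/(_ 1 (subgroup1 sU))]; last by rewrite conjg1.
  exact: fixbJ.
split=> [Kx g [d [e [Dd me ->]]]|Kx d Dd].
  by rewrite conjgM; move: e me; apply/IH; apply: Kx.
by apply/IH => e me; rewrite -conjgM; apply: Kx; exists d, e.
Qed.

(** The intersection is stable under conjugation by the generating set [D], so it is a normal
    subgroup inside the proper closed subgroup [U], hence trivial. *)
Lemma fixb_bigcap x : (forall n, fixb n x) -> x = 1.
Proof.
pose M := [set x | forall n, fixb n x].
have sM : is_subgroup M.
  split; first by move=> n; apply: subgroup1; exact: fixb_subgroup.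
  - by move=> y z My Mz n; apply: subgroupM; [exact: fixb_subgroup|exact: My|exact: Mz].
  - by move=> y My n; apply: subgroupV; [exact: fixb_subgroup|exact: My].
have MD y d : M y -> D d -> M (y ^ d) by move=> My Dd n; apply: (My n.+1).
have : M = [set 1].
  apply: (normal_in_proper HG sM _ _ UT); last by move=> y /(_ 0%N).
  - apply: (stable_gen gD) => d Dd y My; split; apply: MD => //.
    exact: DV.
  - exact: (@fixb_closed 0).
by move=> e Kx; rewrite -[x = 1]/([set 1] x) -e.
Qed.

Lemma fixb_small W : nbhs (1 : G) W -> exists n, fixb n `<=` W.
Proof.
move=> nW; apply: contrapT => no.
have [|||||x [Ux nWx] xF] := @compact_directed G (U `&` ~` W^°) nat setT fixb.
- by apply: compact_closedI => //; apply: open_closedC; exact: open_interior.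
- by exists 0%N.
- by move=> n _; apply: fixb_closed.
- move=> n _; apply: contrapT => /set0P/negP/negPn/eqP e0; apply: no.
  exists n => x xF; apply: interior_subset; apply: contrapT => nWx.
  have : (U `&` ~` W^° `&` fixb n) x by split=> //; split=> //; apply: fixbU xF.
  by rewrite e0.
- move=> i j _ _; exists (i + j)%N => // x Kx.
  by split; apply: fixb_le Kx; [exact: leq_addr|exact: leq_addl].
apply: nWx; rewrite (fixb_bigcap (x := x)); last by move=> n; apply: xF.
by apply: nbhs_singleton; apply: nbhs_interior.
Qed.

Lemma fixb_fin_quot m n : fin_quot (fixb m) (fixb (n + m)).
Proof.
apply: relopen_fin_quot.
- exact: fixb_subgroup.
- exact: fixb_compact.
- exact: fixb_subgroup.
- by apply: fixb_le; exact: leq_addl.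
- by move=> x y Kx /fixbU; apply: fixbJ.
- by exists (fixb (n + m)); [exact: fixb_nbhs|move=> x []].
Qed.

Variable P : finclass.
Hypothesis P1 : forall gT : finGroupType, P gT 1%G.

(* Restricting the action of [fixb n] to the balls of radius [r + 1] around the
   points at distance [n - r] embeds [fixb n / fixb (n + 1)] into a finite power of
   [X / fixb (r + 1)]. *)
Lemma fixb_residually r X : quot_in P X (fixb r.+1) ->
    (forall m x g, fixb (m.+1 + r) x -> words m.+1 g -> X (x ^ g)) ->
  residually P (fixb r.+1).
Proof.
move=> qX hX.
have q m : quot_in P (fixb r.+1) (fixb (m + r.+1)).
  elim: m => [|m IH]; first by apply: quot_inT => //; exact: fixb_subgroup.
  apply: quot_in_trans IH _; [exact: fixb_subgroup|exact: fixb_fin_quot|].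
  (* By [fixb_add], the next stabiliser is the intersection, over words [g] of length [m.+1], of the
     pullbacks of [fixb r.+1] under conjugation by [g]; [hX] puts the conjugates in [X], where the
     quotient is in the class. *)
  apply: (@quot_in_bigcap _ P G (words m.+1)
    (fun g => [set x | fixb (m + r.+1) x /\ fixb r.+1 (x ^ g)])) => //.
  - exact: fixb_subgroup.
  - exact: (@fixb_fin_quot _ 1).
  - move=> g wg; apply: quot_in_pullback qX.
      by move=> x Kx; apply: (hX m) => //; rewrite addSnnS.
    by move=> x y _ _; rewrite conjMg.
  - apply/seteqP; split=> x.
      move=> Kx; split; first exact: fixbS.
      by move=> g wg; split; [exact: fixbS|exact: (fixb_add m.+1 r.+1 x).1].
    by move=> [Kx h]; apply/(fixb_add m.+1) => g /h[].
split; first exact: fixb_subgroup.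
move=> W /fixb_small[n nW]; exists (fixb (n + r.+1)); split => //.
  by move=> x Kx; apply: nW; apply: fixb_le Kx; exact: leq_addr.
by exists (fixb (n + r.+1)); [exact: fixb_nbhs|move=> x []].
Qed.

End Engine.

(** * Envelopes of locally normal subgroups *)

Section Envelope.
Variable G : topologicalGroupType.
Implicit Types (A B D E H K L M U V W X : set G).

(* [E] is a product of finitely many conjugates of [L], cut down to [V].  By
   [env_commg], an element of [D] acts on the neighbourhood [A] of 1 as some
   element of [U] does, modulo [E]. *)
Record envelope U L W D V A E (MM : set (set G)) : Prop := Envelope {
  env_compact : compact D;
  env1 : D 1;
  envUl : forall u d, U u -> D d -> D (u * d);
  envV : forall d, D d -> D d^-1;
  env_gen : gen D = [set: G];
  env_subgroup : is_subgroup V;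
  env_open : open V;
  env_sub : V `<=` U;
  env_finite : finite_set MM;
  env_MM : forall M, MM M -> [/\ is_subgroup M, M `<=` V,
    forall x v, M x -> V v -> M (x ^ v) &
    exists h, forall x, M x -> L (x ^ h) /\ W (x ^ h)];
  env_E : E = gen (\bigcup_(M in MM) M);
  env_EU : forall x u, E x -> U u -> E (x ^ u);
  env_L : L `&` V `<=` E;
  env_nbhs : nbhs (1 : G) A;
  env_AV : A `<=` V;
  env_commg : forall a d, A a -> D d -> exists2 u, U u & E ((a ^ u)^-1 * a ^ d)
}.

Lemma near_seq (T : eqType) (t : seq T) (F : T -> set G) :
  (forall p, p \in t -> nbhs (1 : G) (F p)) ->
  nbhs (1 : G) [set x | forall p, p \in t -> F p x].
Proof.
elim: t => [|p t IH] h; first by apply: filterS filterT.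
have np : nbhs (1 : G) (F p) by apply: h; rewrite inE eqxx.
have nt := IH (fun q qt => h q (mem_behead (s := p :: t) qt)).
apply: filterS2 np nt => x Fx Tx q.
by rewrite inE => /orP[/eqP -> //|]; apply: Tx.
Qed.

Lemma double_coset_compact U (t : seq G) : compact U ->
  compact [set x | exists u g v, [/\ U u, g \in t, U v & x = u * g * v]].
Proof.
move=> cU; have cT : compact [set x | x \in t] by apply: finite_compact; exact: finite_seq.
have c3 := compact_setX (compact_setX cU cT) cU.
have -> : [set x | exists u g v, [/\ U u, g \in t, U v & x = u * g * v]] =
    (fun p : G * G * G => p.1.1 * p.1.2 * p.2) @` ((U `*` [set x | x \in t]) `*` U).
  apply/seteqP; split=> [_ [u [g [v [Uu gt Uv ->]]]]|_ [[[u g] v] [[Uu gt] Uv] <-]].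
    by exists (u, g, v).
  by exists u, g, v.
apply: continuous_compact c3; apply: continuous_subspaceT => p.
apply: mul_cvg; last exact: cvg_snd.
apply: mul_cvg.
  by apply: (cvg_comp (fst : G * G * G -> G * G) (fst : G * G -> G)); exact: cvg_fst.
by apply: (cvg_comp (fst : G * G * G -> G * G) (snd : G * G -> G)); [exact: cvg_fst|exact: cvg_snd].
Qed.

Hypothesis HG : class_S G.

Lemma envelope_ex U L W : is_subgroup U -> open U -> compact U ->
    locally_normal L -> L <> [set 1] -> nbhs (1 : G) W ->
  exists D V A E MM, envelope U L W D V A E MM.
Proof.
move=> sU oU cU [sL cL oL] L1 nW.
(* The conjugates of [L] generate a non-trivial normal subgroup, which is dense, so finitely many of
   their elements generate [G] together with [U]. *)
pose A0 : set G := [set x | exists g, L (x ^ g)].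
have LA0 : L `<=` A0 by move=> x Lx; exists 1; rewrite conjg1.
have dA0 : closure (gen A0) = [set: G].
  apply: (normal_dense HG); first exact: gen_subgroup.
    have [x Lx x1] := nontrivial_ex sL L1 => e; apply: x1.
    by rewrite -[x = 1]/([set 1] x) -e; apply: sub_gen; exact: LA0.
  move=> x g; apply: gen_conj => y [h Lh]; apply: sub_gen.
  by exists (g^-1 * h); rewrite -conjgM mulKVg.
have [s sA0 gs] := dense_gen (class_S_compactly_generated HG) sU oU dA0.
pose gof l := xget 1 [set g | L (l ^ g)].
(* Each generator is paired with an element conjugating it into [L]. The extra pair [(1, 1)] puts
   [L] itself among the conjugates, which gives [env_L], and puts 1 in [ts], so that [U] lies in
   [D]. *)
pose t := (1, 1) :: [seq (l, gof l) | l <- s].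
have tL p : p \in t -> L (p.1 ^ p.2).
  rewrite inE => /orP[/eqP ->|/mapP[l ls ->]] /=; first by rewrite conjg1; exact: subgroup1.
  by have [g Lg] := sA0 _ ls; apply: (@xgetPex _ 1 [set g | L (l ^ g)]); exists g.
have nnL : nbhs (1 : G) (normaliser L).
  apply: open_nbhs_nbhs; split=> //; rewrite /normaliser /=.
  by apply/seteqP; split=> [_ [x Lx <-]|x Lx]; [rewrite conjg1|exists x; rewrite ?conjg1].
pose W1 : set G := [set x | forall p, p \in t -> normaliser L (x ^ p.2) /\ W (x ^ p.2)].
have nW1 : nbhs (1 : G) W1.
  by apply: near_seq => p _; apply: filterI; apply: nbhs_conj.
have [V [sV oV VU VW1 VJ]] : exists V, [/\ is_subgroup V, open V, V `<=` U, V `<=` W1 &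
    forall x u, V x -> U u -> V (x ^ u)].
  apply: normal_core => //.
  by have [H [sH oH _ HW]] := compact_open_subgroup HG nW1; exists H.
have VL p x v : p \in t -> V v -> L (x ^ p.2) <-> L ((x ^ v) ^ p.2).
  move=> pt Vv; rewrite (conjJg x v p.2); apply: iff_sym; apply: normaliserP.
  by case: (VW1 v Vv p pt).
(* The trace on [V] of the conjugate by [u] of that conjugate of [L] which contains [p.1]. *)
pose Mf (p : G * G) u : set G := [set x | V x /\ L (x ^ (u^-1 * p.2))].
pose MM := [set M | exists p u, [/\ p \in t, U u & M = Mf p u]].
pose E := gen (\bigcup_(M in MM) M).
pose ts := [seq p.1 | p <- t] ++ [seq p.1^-1 | p <- t].
have tsP g : g \in ts -> exists2 p, p \in t & L (g ^ p.2).
  rewrite mem_cat => /orP[/mapP[p pt ->]|/mapP[p pt ->]]; exists p => //; first exact: tL.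
  by rewrite conjVg; apply: subgroupV => //; apply: tL.
have ts1 : 1 \in ts by rewrite inE eqxx.
have tsV g : g \in ts -> g^-1 \in ts.
  rewrite !mem_cat => /orP[/mapP[p pt ->]|/mapP[p pt ->]].
    by apply/orP; right; apply/mapP; exists p.
  by apply/orP; left; rewrite invgK; apply/mapP; exists p.
pose D : set G := [set x | exists u g v, [/\ U u, g \in ts, U v & x = u * g * v]].
have U1 := subgroup1 sU; have V1 := subgroup1 sV.
have UD : U `<=` D by move=> u Uu; exists u, 1, 1; rewrite !mulg1.
(* The element [b^-1 * b ^ g] is the commutator of [b] and [g]: it must stay in [V]. In [A] the same
   is asked of all [U]-conjugates. *)
pose A' : set G := V `&` [set b | forall g, g \in ts -> V (b^-1 * b ^ g)].
pose A := V `&` [set a | forall u, U u -> A' (a ^ u)].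
have nV := open_nbhs1 sV oV.
have EU x u : E x -> U u -> E (x ^ u).
  move=> Ex Uu; apply: gen_conj Ex => y [_ [p [w [pt Uw ->]]] [Vy Ly]].
  apply: sub_gen; exists (Mf p (w * u)).
    by exists p, (w * u); split=> //; apply: subgroupM.
  split; first exact: VJ.
  by rewrite -conjgM invgM !mulgA mulgV mul1g.
exists D, V, A, E, MM; split=> //.
- exact: double_coset_compact.
- exact: UD.
- move=> u _ Uu [a [g [b [Ua gt Ub ->]]]]; exists (u * a), g, b; split => //.
    exact: subgroupM.
  by rewrite !mulgA.
- move=> _ [a [g [b [Ua gt Ub ->]]]]; exists b^-1, g^-1, a^-1; split.
  + exact: subgroupV.
  + exact: tsV.
  + exact: subgroupV.
  + by rewrite !invgM mulgA.
- apply/seteqP; split=> // x _; have : gen (U `|` [set x | x \in s]) x by rewrite gs.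
  apply: gen_sub; first exact: gen_subgroup.
  move=> y [/UD Dy|ys]; apply: sub_gen => //.
  exists 1, y, 1; split=> //; last by rewrite mulg1 mul1g.
  rewrite mem_cat; apply/orP; left; apply/mapP; exists (y, gof y) => //.
  by rewrite inE; apply/orP; right; apply: map_f.
(* As [V] normalises the conjugates of [L] involved, [Mf p u] depends only on the coset of [u]
   modulo [V]. *)
- have [hs cov] := compact_finite_cosets cU nV.
  apply: (@sub_finite_set _ _ ((fun q : (G * G) * G => Mf q.1 q.2) @`
     ([set` t] `*` [set` hs]))).
    move=> _ [p [u [pt Uu ->]]]; have [h [hhs Uh Vuh]] := cov _ Uu.
    exists (p, h) => //=; apply/seteqP; split=> x [Vx Lx]; split=> //; move: Lx;
      rewrite !conjgM.
      move/(VL p _ (u * h^-1)^-1 pt (subgroupV sV Vuh)).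
      by rewrite -(conjgM x h^-1) invgM invgK mulKg.
    move/(VL p _ (u * h^-1) pt Vuh).
    by rewrite -(conjgM x u^-1) mulKg.
  by apply: finite_image; apply: finite_setX; exact: finite_seq.
- move=> _ [p [u [pt Uu ->]]]; have sMf : is_subgroup (Mf p u).
    split.
    + by split=> //; rewrite conj1g; exact: subgroup1.
    + by move=> x y [Vx Lx] [Vy Ly]; split; rewrite ?conjMg; apply: subgroupM.
    + by move=> x [Vx Lx]; split; rewrite ?conjVg; apply: subgroupV.
  split=> //; first by move=> x [].
    move=> x v [Vx Lx] Vv; split; first exact: subgroupJ.
    rewrite conjgM (conjJg x v); have Vvu : V (v ^ u^-1) by apply: VJ => //; apply: subgroupV.
    by apply: (VL p _ _ pt Vvu).1; rewrite -conjgM.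
  exists (u^-1 * p.2) => x [Vx Lx]; split=> //.
  rewrite conjgM; have /VW1/(_ p pt)[] // : V (x ^ u^-1).
  by apply: VJ => //; apply: subgroupV.
- move=> x [Lx Vx]; apply: sub_gen; exists (Mf (1, 1) 1).
    by exists (1, 1), 1; split=> //; rewrite inE eqxx.
  by split=> //; rewrite mulg1 invg1 conjg1.
- apply: filterI => //; apply: tube => //; apply: filterI => //.
  apply: near_seq => g _.
  have : (fun b : G => b^-1 * b ^ g) @ (1 : G) --> (1^-1 * 1 ^ g : G).
    apply: mul_cvg; first by apply: inv_cvg; exact: cvg_id.
    exact: conj_continuous.
  by rewrite conj1g invg1 mulg1; apply.
- by move=> a [].
(* For [d = u * g * v] the witness is [u * v]. With [b = a ^ u], the commutator of [b] and [g]
   equals [(g^-1) ^ b * g]: it lies in the conjugate of [L] containing [g], which [b] normalises,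
   and in [V] by the choice of [A]. Conjugation by [v] preserves [E]. *)
- move=> a _ [Va Aa] [u [g [v [Uu gts Uv ->]]]].
  exists (u * v); first exact: subgroupM.
  have [Vb /(_ _ gts) Vbg] := Aa u Uu.
  have [p pt Lg] := tsP g gts.
  have -> : (a ^ (u * v))^-1 * a ^ (u * g * v) = ((a ^ u)^-1 * (a ^ u) ^ g) ^ v.
    by rewrite -(mulgA u) conjMg conjVg -!conjgM.
  apply: EU => //; rewrite /E; apply: sub_gen; exists (Mf p 1); first by exists p, 1.
  split=> //; rewrite invg1 mul1g.
  have -> : (a ^ u)^-1 * (a ^ u) ^ g = (g^-1) ^ (a ^ u) * g.
    by rewrite !conjgE !mulgA.
  rewrite conjMg; apply: subgroupM => //.
  apply: (VL p g^-1 (a ^ u) pt Vb).1.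
  by rewrite conjVg; apply: subgroupV.
Qed.

End Envelope.

(** * From a locally normal subgroup to an open subgroup *)

Section Local.
Variable G : topologicalGroupType.
Implicit Types (A B D E H K L M U V W X : set G).
Variable P : finclass.

Lemma residually_conj H M (h : G) : is_subgroup M -> (forall x, M x -> H (x ^ h)) ->
  residually P H -> residually P M.
Proof.
move=> sM MH [sH pH]; split=> // W nW.
have [N [NW [O nO HO] qN]] := pH _ (nbhs_conj h^-1 nW).
exists [set x | M x /\ N (x ^ h)]; split.
- by move=> x [_ /NW]; rewrite /= conjgK.
- exists [set x | O (x ^ h)]; first exact: nbhs_conj.
  by move=> x [Mx Ox]; split=> //; apply: HO; split=> //; apply: MH.
- by apply: quot_in_pullback qN => // x y _ _; rewrite conjMg.
Qed.

Hypothesis HG : class_S G.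
Hypothesis P1 : forall gT : finGroupType, P gT 1%G.

(** [fixb_residually] is applied to the preimage [X] in [V] of the radical of the finite quotient by
    [K r.+1]. The members of [MM] have normal images in the class, so they lie in [X], and hence so
    does [E]. *)
Lemma open_residually L W : locally_normal L -> L <> [set 1] -> nbhs (1 : G) W ->
  residually P (L `&` W) -> exists K, [/\ is_subgroup K, open K, compact K & residually P K].
Proof.
move=> nL L1 nW pL.
have [U [sU oU cU UT]] := proper_compact_open HG.
have [D [V [A [E [MM env]]]]] := envelope_ex HG sU oU cU nL L1 nW.
case: env => cD D1 UD DV gD sV oV VU _ MMP EE EU _ nA AV comm.
pose K := fixb U D.
(* This radius makes [env_commg] applicable to every element of [K r]. *)
have [r KrA] := fixb_small HG sU oU cU UT cD D1 DV gD nA.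
have KS n : K n.+1 `<=` K n by apply: fixbS.
have KV : K r.+1 `<=` V by move=> x /KS/KrA/AV.
have fqV : fin_quot V (K r.+1).
  have := fixb_fin_quot sU oU cU cD D1 UD 0 r.+1; rewrite addn0.
  move=> /(fin_quotS VU); rewrite (_ : V `&` _ = K r.+1) //.
  by apply/seteqP; split=> x; [case|move=> Kx; split=> //; apply: KV].
have [gT [f [mf eK]]] := fqV.
have [B BE] := image_group sV mf.
have [R PR Rmax] := @fc_radical P gT B (P1 gT).
pose X : set G := [set x | V x /\ f x \in R].
have sX : is_subgroup X.
  split.
  - by split; [exact: subgroup1|rewrite (morph_on1 sV mf)].
  - by move=> x y [Vx Rx] [Vy Ry]; split; [exact: subgroupM|rewrite mf // groupM].
  - by move=> x [Vx Rx]; split; [exact: subgroupV|rewrite (morph_onV sV) // groupV].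
have KX : K r.+1 `<=` X.
  by rewrite eK => x [Vx fx]; split; rewrite // fx.
have qX : quot_in P X (K r.+1).
  exists gT, R, f; split=> //; first by move=> x [].
    by move=> x y [Vx _] [Vy _]; apply: mf.
  rewrite eK; apply/seteqP; split=> x [Vx fx]; split=> //; last by case: Vx.
  by split=> //; rewrite fx.
have EX : E `<=` X.
  rewrite EE; apply: gen_sub => // x [M MM_M Mx].
  have [sM MV MJ [h Mh]] := MMP M MM_M.
  have [_ pM] := residually_conj sM Mh pL.
  have [N [NK _ qN]] := pM _ (fixb_nbhs sU oU cD r.+1).
  have mfM : morph_on M f by move=> y z My Mz; apply: mf; apply: MV.
  have [C CE] := image_group sM mfM.
  split; first exact: MV.
  have : f x \in C by apply/CE; exists x.
  apply: (fintype.subsetP (Rmax C _ _)).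
    apply/andP; split.
      by apply/fintype.subsetP => _ /CE[y My <-]; apply/BE; exists y => //; apply: MV.
    apply/fintype.subsetP => _ /BE[y Vy <-]; rewrite inE; apply/fintype.subsetP => z.
    rewrite mem_conjg => /CE[w Mw ew]; apply/CE; exists (w ^ y); first exact: MJ.
    by rewrite (morph_onJ sV) // ?ew ?conjgKV //; apply: MV.
  apply: (quot_in_image sM mfM qN) => [y Ny|y /CE//].
  have : K r.+1 y by apply: NK.
  by rewrite eK => -[_ fy]; split=> //; apply: (quot_in_sub qN).
have sE : is_subgroup E by rewrite EE; exact: gen_subgroup.
(* An element fixing a large ball around the base point looks the same, modulo
   [E] and conjugation in [U], from every vertex well inside that ball. *)
have cong m : forall x g, K (m + r) x -> words U D m g ->
    exists2 u, U u & E ((x ^ u)^-1 * x ^ g).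
  elim: m => [|m IH] x g Kx; first by exists g => //; rewrite mulVg; exact: subgroup1.
  move=> [d [e [Dd we ->]]].
  have [|u Uu Eu] := comm x d _ Dd.
    by apply: KrA; apply: (fixb_le D1 _ Kx); rewrite addSn leqW // leq_addl.
  have [v Uv Ev] := IH (x ^ d) e (Kx d Dd) we.
  exists (u * v); first exact: subgroupM.
  have := subgroupM sE (EU _ _ Eu Uv) Ev.
  rewrite conjMg conjVg -!conjgM mulgA; congr (E (_ * _)).
  by rewrite -mulgA mulgV mulg1.
exists (K r.+1); split.
- exact: fixb_subgroup.
- exact: fixb_open.
- exact: fixb_compact.
apply: (fixb_residually HG sU oU cU UT cD D1 UD DV gD P1 qX) => m x g Kx wg.
(* [x ^ g] is the product of [x ^ u], which stays in [K r.+1], and an element of [E]; both lie in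
   [X]. *)
have [u Uu Eu] := cong _ _ _ Kx wg.
rewrite -(mulKVg (x ^ u) (x ^ g)); apply: subgroupM => //; last exact: EX.
apply: KX; apply: fixbJ => //.
by apply: (fixb_le D1 _ Kx); rewrite addSn ltnS leq_addl.
Qed.

End Local.

(** * Sylow subgroups of compact groups *)

Section Sylow.
Variable G : topologicalGroupType.
Implicit Types (A H K M S T W : set G).

(** Sylow subgroups of finite quotients are kept as full preimages in [H], so that compatible
    choices form a decreasing sequence. [B] is the image of [H], as [f] need not be onto. *)
Definition sylow_over (p : nat) H N S := exists (gT : finGroupType) (f : G -> gT)
  (B Q : {group gT}), [/\ morph_on H f, N = ker_on H f,
    forall y, y \in B <-> exists2 x, H x & f x = y, p.-Sylow(B) Q &
    S = [set x | H x /\ f x \in Q]].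

Lemma sylow_over_ex p H N : is_subgroup H -> fin_quot H N -> exists S, sylow_over p H N S.
Proof.
move=> sH [gT [f [mf eN]]]; have [B BE] := image_group sH mf.
have [Q SQ] := Sylow_exists p B.
by exists [set x | H x /\ f x \in Q], gT, f, B, Q.
Qed.

Lemma sylow_over_subgroup p H N S : is_subgroup H -> sylow_over p H N S ->
  [/\ is_subgroup S, S `<=` H & N `<=` S].
Proof.
move=> sH [gT [f [B [Q [mf -> BE SQ ->]]]]]; split.
- split.
  + by split; [exact: subgroup1|rewrite (morph_on1 sH mf)].
  + by move=> x y [Hx Qx] [Hy Qy]; split; [exact: subgroupM|rewrite mf // groupM].
  + by move=> x [Hx Qx]; split; [exact: subgroupV|rewrite (morph_onV sH) // groupV].
- by move=> x [].
- by move=> x [Hx fx]; split; rewrite // fx.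
Qed.

(** A Sylow subgroup of the larger quotient maps onto a Sylow subgroup of the smaller one. That
    image is conjugate to the given subgroup, and the conjugating element lifts. *)
Lemma sylow_over_lift p H N N' S : is_subgroup H -> fin_quot H N' -> N' `<=` N ->
    sylow_over p H N S ->
  exists S', [/\ sylow_over p H N' S', S' `<=` S &
    forall x, S x -> exists2 y, S' y & N (x * y^-1)].
Proof.
move=> sH [hT [f' [mf' eN']]] N'N [gT [f [B [Q [mf eN BE SQ eS]]]]].
have [B' BE'] := image_group sH mf'.
have [|t tE] := morph_on_factor sH mf' mf _ BE'; first by rewrite -eN' -eN.
have tB : (t @* B')%g = B.
  apply/finset.setP => y; apply/idP/idP.
    by case/morphimP => z _ /BE'[x Hx <-] ->; apply/BE; exists x; rewrite // tE.
  case/BE => x Hx <-; apply/morphimP.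
  have B'x : f' x \in B' by apply/BE'; exists x.
  by exists (f' x); rewrite // tE.
have [Q0 SQ0] := Sylow_exists p B'.
have SQ1 : p.-Sylow(B) (t @* Q0)%G.
  rewrite -tB; apply: morphim_pHall => //; exact: pHall_sub SQ0.
have [y By eQ] := Sylow_trans SQ1 SQ.
have : y \in (t @* B')%g by rewrite tB.
case/morphimP => b' _ B'b' ey.
pose Q' := (Q0 :^ b')%G.
have SQ' : p.-Sylow(B') Q' by rewrite pHallJ.
have tQ' : (t @* Q')%g = Q.
  by rewrite eQ ey /= morphimJ.
have sQB : Q' \subset B' := pHall_sub SQ'.
exists [set x | H x /\ f' x \in Q']; split.
- by exists hT, f', B', Q'.
- move=> x [Hx Qx]; rewrite eS; split=> //; rewrite -tQ' -tE //.
  by apply: mem_morphim => //; apply/BE'; exists x.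
- move=> x; rewrite {1}eS => -[Hx]; rewrite -tQ' => /morphimP[q B'q Qq fq].
  have /BE'[y' Hy' ey'] := B'q.
  exists y'; first by split; rewrite // ey'.
  rewrite eN; split; first by apply: subgroupM => //; apply: subgroupV.
  by rewrite mf ?(morph_onV sH) // ?fq -?ey' ?tE ?mulgV //; apply: subgroupV.
Qed.

Variables (p : nat) (H : set G) (M : nat -> set G).
Hypotheses (hG : hausdorff_space G) (sH : is_subgroup H) (cH : compact H).
Hypotheses (qM : forall n, fin_quot H (M n)) (rM : forall n, relopen H (M n))
  (MS : forall n, M n.+1 `<=` M n)
  (Msmall : forall W, nbhs (1 : G) W -> exists n, M n `<=` W).

Let clH : closed H := compact_closed hG cH.

Let M_subgroup n : is_subgroup (M n).
Proof. by have [gT [f [mf ->]]] := qM n; apply: ker_on_subgroup. Qed.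

Let M_sub n : M n `<=` H.
Proof. by have [gT [f [mf ->]]] := qM n => x []. Qed.

Let M_le m n : (m <= n)%N -> M n `<=` M m.
Proof.
by move/subnK <-; elim: (n - m)%N => // k IH x; rewrite addSn => /MS/IH.
Qed.

Let M_closed n : closed (M n).
Proof. exact: relopen_closed (M_subgroup n) (@M_sub n) (rM n). Qed.

Lemma sylow_sequence : exists S : nat -> set G,
  [/\ forall n, sylow_over p H (M n) (S n), forall n, S n.+1 `<=` S n &
      forall n x, S n x -> exists2 y, S n.+1 y & M n (x * y^-1)].
Proof.
pose next n (S S' : set G) := [/\ sylow_over p H (M n.+1) S', S' `<=` S &
  forall x, S x -> exists2 y, S' y & M n (x * y^-1)].
have [S0 S0P] := sylow_over_ex p sH (qM 0).
pose S := fix S n : set G := if n is n.+1 then xget set0 (next n (S n)) else S0.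
have nextP n : sylow_over p H (M n) (S n) -> next n (S n) (S n.+1).
  move=> Sn; have [S' S'P] := sylow_over_lift sH (qM n.+1) (@MS n) Sn.
  by apply: (@xgetPex _ set0 (next n (S n))); exists S'.
have SP n : sylow_over p H (M n) (S n).
  by elim: n => // n /nextP[].
by exists S; split=> // n; have [] := nextP n (SP n).
Qed.

(** The intersection [Q] of a compatible sequence is a pro-p group covering every Sylow subgroup
    [S n] modulo [M n]. If [Q] is finite, some [M m] meets it trivially; then the image of [M m]
    modulo each smaller [M n] has trivial Sylow p-subgroup. *)
Lemma sylow_dichotomy :
  (exists Q, [/\ Q `<=` H, compact Q, residually (pi_class p) Q & infinite_set Q]) \/
  (exists n, residually (pi_class (negn p)) (M n)).
Proof.
have [S [SP SS SL]] := sylow_sequence.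
have sS n : is_subgroup (S n) by have [] := sylow_over_subgroup sH (SP n).
have SH n : S n `<=` H by have [] := sylow_over_subgroup sH (SP n).
have MSn n : M n `<=` S n by have [] := sylow_over_subgroup sH (SP n).
have S_le m n : (m <= n)%N -> S n `<=` S m.
  by move/subnK <-; elim: (n - m)%N => // k IH x; rewrite addSn => /SS/IH.
have clS n : closed (S n).
  apply: (relopen_closed sH clH (sS n) (@SH n)).
  by have [O nO HO] := rM n; exists O => // x /HO /MSn.
pose Q := \bigcap_n S n.
have sQ : is_subgroup Q.
  split.
  - by move=> n _; apply: subgroup1.
  - by move=> x y Qx Qy n _; apply: subgroupM; [|exact: Qx|exact: Qy].
  - by move=> x Qx n _; apply: subgroupV => //; apply: Qx.
have QH : Q `<=` H by move=> x /(_ 0%N I) /SH.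
have cQ : compact Q.
  by apply: subclosed_compact cH QH; apply: closed_bigI => n _.
(* The elements of [S (j + n)] congruent to [x] modulo [M n] form decreasing non-empty closed sets;
   a common point lies in [Q]. *)
have lift n x : S n x -> exists2 y, Q y & M n (x * y^-1).
  move=> Sx; pose F j := [set y | S (j + n)%N y /\ M n (x * y^-1)].
  have [||||y Hy yF] := @compact_directed G H nat setT F cH.
  - by exists 0%N.
  - move=> j _; apply: closedI => //.
    apply: (@preimage_closed _ _ (fun y : G => x * y^-1)) => // y _.
    by apply: mul_cvg; [exact: cvg_cst|apply: inv_cvg; exact: cvg_id].
  - move=> j _; elim: j => [|j [y [_ [Sy My]]]].
      by exists x; split; [exact: SH Sx|split=> //; rewrite mulgV; exact: subgroup1].
    have [z Sz Mz] := SL _ _ Sy; exists z; split; first exact: SH Sz.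
    split=> //; rewrite -(mulgVK y x) -mulgA; apply: subgroupM => //.
    by apply: M_le Mz; exact: leq_addl.
  - move=> i j _ _; exists (i + j)%N => // y [Sy My].
    by split; split=> //; apply: S_le Sy; rewrite leq_add2r ?leq_addr ?leq_addl.
  exists y; last by have [_] := yF 0%N I.
  by move=> k _; have [Sy _] := yF k I; apply: S_le Sy; exact: leq_addr.
have proQ : residually (pi_class p) Q.
  split=> // W /Msmall[n MW]; exists (Q `&` M n); split.
  - by move=> x [_ /MW].
  - have [O nO HO] := rM n; exists O => // x [Qx Ox]; split=> //.
    by apply: HO; split=> //; apply: QH.
  - have [gT [f [B [R [mf eM BE SR eS]]]]] := SP n.
    exists gT, R, f; split.
    + exact: pHall_pgroup SR.
    + by move=> x /(_ n I); rewrite eS => -[].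
    + by move=> x y Qx Qy; apply: mf; apply: QH.
    + rewrite eM; apply/seteqP; split=> x [Qx fx]; split=> //; first by case: fx.
      by split=> //; apply: QH.
have [finQ|infQ] := pselect (finite_set Q); last by left; exists Q.
right.
have [m Qm] : exists m, forall x, Q x -> M m x -> x = 1.
  have : nbhs (1 : G) (~` (Q `\ 1)).
    apply: open_nbhs_nbhs; split; last by move=> [_]; apply.
    apply: closed_openC; apply: (accessible_finite_set_closed.1 (hausdorff_accessible hG)).
    exact: finite_setD.
  move=> /Msmall[m Mm]; exists m => x Qx /Mm nx; apply: contrapT => x1.
  by apply: nx.
exists m; split=> // W /Msmall[n0 MW]; pose n := (n0 + m)%N.
have Mnm : M n `<=` M m by apply: M_le; exact: leq_addl.
exists (M n); split.
- by move=> x Mx; apply: MW; apply: M_le Mx; exact: leq_addr.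
- have [O nO HO] := rM n; exists O => // x [Mx Ox]; apply: HO; split=> //.
  exact: M_sub Mx.
have [gT [f [B [R [mf eM BE SR eS]]]]] := SP n.
have mfM : morph_on (M m) f by move=> x y Mx My; apply: mf; apply: M_sub; eassumption.
have [C CE] := image_group (M_subgroup m) mfM.
exists gT, C, f; split=> //; last 1 first.
- apply/seteqP; split=> x; last first.
    by move=> [Mx fx]; rewrite eM; split=> //; apply: M_sub Mx.
  by move=> Mx; split; [exact: Mnm|move: Mx; rewrite eM => -[]].
- have nCB : C <| B.
    have [gm [fm [mfm em]]] := qM m.
    apply/andP; split.
      by apply/fintype.subsetP => _ /CE[x Mx <-]; apply/BE; exists x => //; apply: M_sub Mx.
    apply/fintype.subsetP => _ /BE[x Hx <-]; rewrite inE; apply/fintype.subsetP => y.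
    rewrite mem_conjg => /CE[z Mz ez]; apply/CE; exists (z ^ x).
      move: Mz; rewrite em => -[Hz fz].
      by split; [exact: subgroupJ|rewrite (morph_onJ sH) // fz conj1g].
    by rewrite (morph_onJ sH) // ?ez ?conjgKV //; apply: M_sub Mz.
  have SC := Sylow_setI_normal nCB SR.
  have CR1 : C :&: R = 1%g.
    apply/trivgP; apply/fintype.subsetP => y /setIP[/CE[k Mk <-] Rk].
    have Sk : S n k by rewrite eS; split=> //; apply: M_sub Mk.
    (* [s] is congruent modulo [M n] to [k], an element of [M m], so [s] lies in both [Q] and [M m];
       thus [s] is 1 and [k] is in [M n]. *)
    have [s Qs Ms] := lift n k Sk.
    have s1 : s = 1.
      apply: Qm => //; rewrite -(mulKg (k * s^-1) s) mulgVK.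
      by apply: subgroupM => //; apply: subgroupV => //; apply: Mnm.
    have : ker_on H f k by rewrite -eM; move: Ms; rewrite s1 invg1 mulg1.
    by move=> [_ ->]; rewrite inE.
  rewrite /= /pgroup -partn_eq1 ?cardG_gt0 //.
  have := card_Hall SC; have -> : gval (C :&: R)%G = 1%g by [].
  by rewrite cards1 => <-.
- by move=> x Mx; apply/CE; exists x.
Qed.

End Sylow.

(** * Derived series *)

Section Derived.
Variable G : groupType.
Implicit Types A F H K M N V : set G.

Lemma derived_subgroup H : is_subgroup (derived H).
Proof. exact: gen_subgroup. Qed.

Lemma commg_derived H x y : H x -> H y -> derived H [~ x, y].
Proof. by move=> Hx Hy; apply: sub_gen; exists x, y. Qed.

Lemma derived_sub H K : is_subgroup K ->
  (forall x y, H x -> H y -> K [~ x, y]) -> derived H `<=` K.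
Proof. by move=> sK HK; apply: gen_sub => // _ [x [y [Hx Hy ->]]]; apply: HK. Qed.

Lemma derivedS H K : H `<=` K -> derived H `<=` derived K.
Proof.
move=> HK; apply: derived_sub; first exact: derived_subgroup.
by move=> x y /HK Kx /HK Ky; apply: commg_derived.
Qed.

Lemma iter_derivedS n H K : H `<=` K -> iter n derived H `<=` iter n derived K.
Proof. by move=> HK; elim: n => //= n; apply: derivedS. Qed.

Lemma iter_derived_subgroup n H : is_subgroup H -> is_subgroup (iter n derived H).
Proof. by case: n => // n _; apply: derived_subgroup. Qed.

Lemma iter_derived_sub n H : is_subgroup H -> iter n derived H `<=` H.
Proof.
move=> sH; elim: n => //= n IH; apply: derived_sub => // x y /IH Hx /IH Hy.
by rewrite commgEl; apply: subgroupM; [|exact: subgroupV|exact: subgroupJ].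
Qed.

Lemma iter_derivedJ n H K (g : G) : (forall x, H x -> K (x ^ g)) ->
  forall x, iter n derived H x -> iter n derived K (x ^ g).
Proof.
move=> HK; elim: n => //= n IH.
have sK := derived_subgroup (iter n derived K).
apply: derived_sub => [|x y Hx Hy]; last first.
  by rewrite /= conjRg; apply: commg_derived; apply: IH.
split=> /=; first by rewrite conj1g; exact: subgroup1.
- by move=> x y; rewrite conjMg; apply: subgroupM.
- by move=> x; rewrite conjVg; apply: subgroupV.
Qed.

(* This is the product [M F] when [M] and [F] lie in [V]. *)
Definition mulN V M F := [set x | V x /\ exists2 f, F f & M (x * f^-1)].

Section Product.
Variables V M : set G.
Hypotheses (sV : is_subgroup V) (sM : is_subgroup M) (MV : M `<=` V)
  (MJ : forall x v, M x -> V v -> M (x ^ v)).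

Let cong_mul x y a b : V x -> V y -> V a -> V b ->
  M (x * a^-1) -> M (y * b^-1) -> M (x * y * (a * b)^-1).
Proof.
move=> Vx Vy Va Vb Mx My.
have -> : x * y * (a * b)^-1 = (y * b^-1) ^ x^-1 * (x * a^-1).
  by rewrite conjgE invgK invgM !mulgA mulgVK.
by apply: subgroupM => //; apply: MJ => //; apply: subgroupV.
Qed.

Let cong_inv x a : V x -> V a -> M (x * a^-1) -> M (x^-1 * (a^-1)^-1).
Proof.
move=> Vx Va Mx; have -> : x^-1 * (a^-1)^-1 = (x * a^-1)^-1 ^ x.
  by rewrite conjgE !invgM !invgK -!mulgA mulVg mulg1.
by apply: MJ => //; apply: subgroupV.
Qed.

Lemma mulN_subgroup F : is_subgroup F -> F `<=` V -> is_subgroup (mulN V M F).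
Proof.
move=> sF FV; split.
- by split; [exact: subgroup1|exists 1; [exact: subgroup1|rewrite mulgV; exact: subgroup1]].
- move=> x y [Vx [f Ff Mf]] [Vy [h Fh Mh]]; split; first exact: subgroupM.
  by exists (f * h); [exact: subgroupM|apply: cong_mul; auto].
- move=> x [Vx [f Ff Mf]]; split; first exact: subgroupV.
  by exists f^-1; [exact: subgroupV|apply: cong_inv; auto].
Qed.

(** Congruence modulo [M], which is normal in [V], respects products and inverses, hence
    commutators. *)
Lemma derived_mulN F : is_subgroup F -> F `<=` V ->
  derived (mulN V M F) `<=` mulN V M (derived F).
Proof.
move=> sF FV; apply: derived_sub.
  apply: mulN_subgroup; first exact: derived_subgroup.
  by move=> x /(@iter_derived_sub 1 _ sF)/FV.
move=> x y [Vx [f Ff Mf]] [Vy [h Fh Mh]]; split.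
  by rewrite commgEl; apply: subgroupM; [|exact: subgroupV|exact: subgroupJ].
exists [~ f, h]; first exact: commg_derived.
have [Vf Vh] : V f /\ V h by split; apply: FV.
have Vx' := subgroupV sV Vx; have Vy' := subgroupV sV Vy.
have Vf' := subgroupV sV Vf; have Vh' := subgroupV sV Vh.
have Vxy := subgroupM sV Vx Vy; have Vfh := subgroupM sV Vf Vh.
rewrite !commgEl !conjgE.
apply: cong_mul => //; [exact: subgroupM|exact: subgroupM|exact: cong_inv|].
by apply: cong_mul => //; [exact: cong_inv|exact: cong_mul].
Qed.

Lemma iter_derived_mulN n F : is_subgroup F -> F `<=` V ->
  iter n derived (mulN V M F) `<=` mulN V M (iter n derived F).
Proof.
move=> sF FV; elim: n => // n IH x /(derivedS IH).
apply: derived_mulN; first exact: iter_derived_subgroup.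
by move=> y /(iter_derived_sub sF)/FV.
Qed.

End Product.

(** Induction on the family: if [F] is killed by [n] derivations, [n] derivations push the product
    of [M] and [F] into [M], and [m] more kill [M]. *)
Lemma gen_family_soluble V (s : seq (set G)) : is_subgroup V ->
    (forall M, M \in s -> [/\ is_subgroup M, M `<=` V,
       forall x v, M x -> V v -> M (x ^ v) & exists n, iter n derived M `<=` [set 1]]) ->
  exists n, iter n derived (gen (\bigcup_(M in [set` s]) M)) `<=` [set 1].
Proof.
move=> sV; elim: s => [|M s IH] hs.
  exists 0%N => /=; apply: gen_sub; last by move=> x [].
  by split; [|move=> _ _ -> ->; rewrite mulg1|move=> _ ->; rewrite invg1].
have [N Ns|n nF] := IH; first by apply: hs; rewrite inE Ns orbT.
have [|sM MV MJ [m nM]] := hs M; first by rewrite inE eqxx.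
set F := gen _ in nF; have sF : is_subgroup F by exact: gen_subgroup.
have FV : F `<=` V.
  apply: gen_sub => // x [N /= Ns Nx].
  by have [|_ + _ _] := hs N; [rewrite inE Ns orbT|apply].
exists (m + n)%N; rewrite iterD; apply: subset_trans nM; apply: iter_derivedS.
apply: subset_trans (_ : mulN V M (iter n derived F) `<=` M); last first.
  by move=> x [_ [f /nF -> ]]; rewrite invg1 mulg1.
apply: subset_trans (iter_derived_mulN sV sM MJ sF FV).
apply: iter_derivedS; apply: gen_sub; first exact: mulN_subgroup.
move=> x [N /=]; rewrite inE => /orP[/eqP -> Mx|Ns Nx].
  split; first exact: MV.
  by exists 1; [exact: subgroup1|rewrite invg1 mulg1].
have Fx : F x by apply: sub_gen; exists N.
by split; [exact: FV|exists x; rewrite // mulgV; exact: subgroup1].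
Qed.

End Derived.

(** * Virtually soluble locally normal subgroups *)

Section ClosureSoluble.
Variable G : topologicalGroupType.
Implicit Types A H K L W : set G.

Lemma commg_cvg (x y : G) : (fun p : G * G => [~ p.1, p.2]) @ (x, y) --> [~ x, y].
Proof.
apply: (@mul_cvg G _ _ (fun p : G * G => p.1^-1) (fun p => p.1 ^ p.2)).
  by apply: inv_cvg; exact: cvg_fst.
by apply: conj_cvg; [exact: cvg_fst|exact: cvg_snd].
Qed.

Lemma derived_closure H : derived (closure H) `<=` closure (derived H).
Proof.
apply: derived_sub; first by apply: closure_subgroup; exact: derived_subgroup.
move=> x y cx cy W /(@commg_cvg x y) [[A B] /= [nA nB] sub].
have [a [Ha Aa]] := cx _ nA; have [b [Hb Bb]] := cy _ nB.
by exists [~ a, b]; split; [exact: commg_derived|exact: (sub (a, b))].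
Qed.

Lemma iter_derived_closure n H :
  iter n derived (closure H) `<=` closure (iter n derived H).
Proof. by elim: n => // n IH x /(derivedS IH)/derived_closure. Qed.

Lemma closed1 : hausdorff_space G -> closed [set (1 : G)].
Proof. by move=> hG; apply/accessible_closed_set1/hausdorff_accessible. Qed.

Lemma closure_mull (g x : G) H : closure [set g * k | k in H] x -> closure H (g^-1 * x).
Proof.
move=> cl W nW.
have [|_ [[k Hk <-] /= Wk]] := cl [set y | W (g^-1 * y)].
  exact: mull_continuous nW.
by exists k; split=> //; move: Wk; rewrite mulKg.
Qed.

(* [K] itself need not be closed. *)
Lemma finite_index_closure K L : is_subgroup K -> finite_index K L ->
  exists2 W, nbhs (1 : G) W & L `&` W `<=` closure K.
Proof.
move=> sK /finite_seqP[s es].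
(* This neighbourhood avoids the finitely many cosets whose closure misses 1. A point [x] of [L] in
   it lies in a coset [x K] with 1 in its closure, so the inverse of [x] is in the closure of
   [K]. *)
exists [set x | forall C, C \in s -> ~ closure C 1 -> ~ C x].
  apply: near_seq => C _.
  have [c1|nc1] := pselect (closure C 1); first by apply: filterS filterT.
  have [B nB BC] : exists2 B, nbhs (1 : G) B & ~ (C `&` B !=set0).
    by apply: contrapT => no; apply: nc1 => B nB; apply: contrapT => h; apply: no; exists B.
  by apply: filterS nB => x Bx _ Cx; apply: BC; exists x.
move=> x [Lx Wx]; have xs : [set x * k | k in K] \in s.
  have : [set [set x * k | k in K] | x in L] [set x * k | k in K] by exists x.
  by rewrite es.
have Kx : [set x * k | k in K] x by exists 1; [exact: subgroup1|rewrite mulg1].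
have [c1|nc1] := pselect (closure [set x * k | k in K] 1); last by case: (Wx _ xs nc1).
have := closure_mull c1; rewrite mulg1 => cx.
rewrite -(invgK x); exact: subgroupV (closure_subgroup sK) cx.
Qed.

Hypothesis HG : class_S G.
Let hG := class_S_hausdorff HG.

(** If [L] were discrete, [open_residually] for the class of trivial groups, obtained from the empty
    set of primes, would give a trivial open subgroup, and [G] would be discrete. *)
Lemma locally_normal_nontrivial L W : locally_normal L -> L <> [set 1] ->
  nbhs (1 : G) W -> ~ L `&` W `<=` [set 1].
Proof.
move=> nL L1 nW LW; have [sL _ _] := nL.
have L1' := subgroup1 sL; have W1 := nbhs1 nW.
have eLW : L `&` W = [set 1] by apply/seteqP; split=> // _ ->.
have P1 gT : pi_class pred0 gT 1%G by exact: pgroup1.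
have pLW : residually (pi_class pred0) (L `&` W).
  rewrite eLW; have s1 : is_subgroup [set (1 : G)].
    by split; [|move=> _ _ -> ->; rewrite mulg1|move=> _ ->; rewrite invg1].
  split=> // O nO; exists [set 1]; split; last exact: quot_inT.
    by move=> _ ->; exact: nbhs1.
  by exists setT; [exact: filterT|move=> x []].
have [K [sK oK _ [_ pK]]] := open_residually HG P1 nL L1 nW pLW.
apply: (not_nbhs1 HG); apply: filterS (open_nbhs1 sK oK) => x Kx.
apply: contrapT => /(setC1_nbhs HG) /pK[N [Nx _ [gT [A [f [pA fA mf eN]]]]]].
apply: (Nx x) => //; rewrite eN; split=> //.
have A1 : A :=: 1%g.
  apply/eqP; rewrite trivg_card1; apply: contraT => A1.
  have pd : prime (pdiv #|A|).
    by apply: pdiv_prime; rewrite ltn_neqAle eq_sym A1 cardG_gt0.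
  by have := pgroupP pA _ pd (pdiv_dvd _).
by have := fA x Kx; rewrite A1 inE => /eqP.
Qed.

Lemma locally_normal_soluble L n W : locally_normal L -> nbhs (1 : G) W ->
  iter n derived (L `&` W) `<=` [set 1] -> L = [set 1].
Proof.
move=> nL nW solL; apply: contrapT => L1.
have [U [sU oU cU UT]] := proper_compact_open HG.
have clU := compact_closed hG cU.
have [D [V [A [E [MM env]]]]] := envelope_ex HG sU oU cU nL L1 nW.
case: env => cD D1 UD DV gD sV oV VU fMM MMP EE EU LVE nA AV comm.
have sE : is_subgroup E by rewrite EE; exact: gen_subgroup.
(* Every member of [MM] is normal in [V] and conjugate into the soluble group [L] cut down to
   [W]. *)
have [c solE] : exists c, iter c derived E `<=` [set 1].
  rewrite EE; have /finite_seqP[s es] := fMM; rewrite es; apply: gen_family_soluble sV _.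
  move=> M Ms; have [|sM MV MJ [h Mh]] := MMP M; first by rewrite es.
  split=> //; exists n => x /(@iter_derivedJ _ n M (L `&` W) h Mh) /solL /= e.
  by rewrite -(conjgK h x) e conj1g.
(* Conjugation by [g] carries small elements of [E] into [E]. This holds on [D] by [env_commg] and
   passes to products, so [G] commensurates [E]. *)
pose cmm g := exists2 O, nbhs (1 : G) O & forall x, E x -> O x -> E (x ^ g).
have cmm_all g : cmm g.
  have cmmM a b : cmm a -> cmm b -> cmm (a * b).
    move=> [O nO aO] [O' nO' bO']; exists (O `&` [set x | O' (x ^ a)]).
      by apply: filterI => //; apply: nbhs_conj.
    by move=> x Ex [Ox O'x]; rewrite conjgM; apply: bO' => //; apply: aO.
  have cmmD d : D d -> cmm d.
    move=> Dd; exists A => // x Ex Ax; have [u Uu Eu] := comm x d Ax Dd.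
    by rewrite -(mulKVg (x ^ u) (x ^ d)); apply: subgroupM => //; apply: EU.
  suff : gen D `<=` [set g | cmm g /\ cmm g^-1] by rewrite gD => /(_ g I)[].
  apply: gen_sub => [|d Dd]; last by split; apply: cmmD => //; apply: DV.
  split=> [|a b [ca ca'] [cb cb']|a [ca ca']].
  - by rewrite /= invg1; split; exists setT; (try exact: filterT) => x; rewrite conjg1.
  - by rewrite /= invgM; split; apply: cmmM.
  - by rewrite /= invgK.
pose good O := [/\ is_subgroup O, nbhs (1 : G) O, O `<=` U &
  forall x u, O x -> U u -> O (x ^ u)].
have goodP O' : nbhs (1 : G) O' -> exists2 O, good O & O `<=` O'.
  move=> nO'; have [H [sH oH _ HO']] := compact_open_subgroup HG nO'.
  have [|O [sO oO OU OH OJ]] := @normal_core G U O' sU cU oU; first by exists H.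
  exists O => //.
  by split=> //; apply: open_nbhs1.
(* With [k + 1] the least derived length of the groups [E `&` O] and [O0]
   realising it, the conjugates of the abelian group [N0] generate a dense
   subgroup, and each centralises [iter k derived (E `&` O)] for small [O]. *)
pose Q k O := iter k derived (E `&` O) `<=` [set 1].
have Qex : exists k, `[< exists2 O, good O & Q k O >].
  exists c; apply/asboolP; have [O gO _] := goodP setT filterT; exists O => //.
  by apply: subset_trans solE; apply: iter_derivedS => x [].
(* Least length 0 would make [L] trivial near 1, against [locally_normal_nontrivial]. *)
case: (ex_minnP Qex) => -[|k] /asboolP[O0 gO0 QO0] kmin.
  have [_ nO0 _ _] := gO0.
  apply: (locally_normal_nontrivial nL L1 (filterI (open_nbhs1 sV oV) nO0)).
  by move=> x [Lx [Vx Ox]]; apply: QO0; split=> //; apply: LVE.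
have kmin' O : good O -> ~ Q k O.
  move=> gO QO; have := kmin k; rewrite ltnn => h; suff : false by [].
  by apply: h; apply/asboolP; exists O.
have [sO0 nO0 O0U O0J] := gO0.
have sEO O : good O -> is_subgroup (E `&` O).
  move=> [sO _ _ _]; split; first by split; exact: subgroup1.
    by move=> x y [Ex Ox] [Ey Oy]; split; exact: subgroupM.
  by move=> x [Ex Ox]; split; exact: subgroupV.
pose N0 := iter k derived (E `&` O0).
have N0c x y : N0 x -> N0 y -> x ^ y = x.
  move=> Nx Ny; apply/conjg_fixP/eqP.
  by have := QO0 [~ x, y]; apply; exact: commg_derived.
pose A0 : set G := [set x | exists g, N0 (x ^ g)].
have dA0 : closure (gen A0) = [set: G].
  apply: (normal_dense HG); first exact: gen_subgroup.
    move=> e; apply: (kmin' O0 gO0) => x Nx; rewrite -e; apply: sub_gen.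
    by exists 1; rewrite conjg1.
  move=> x g; apply: gen_conj => y [h Lh]; apply: sub_gen.
  by exists (g^-1 * h); rewrite -conjgM mulKVg.
have [s sA0 gs] := dense_gen (class_S_compactly_generated HG) sU oU dA0.
(* For each of the finitely many generators, the element conjugating it into [N0] must also carry
   the part of [E] in [O'] into that of [O0]. *)
have [O' nO' O'P] : exists2 O', nbhs (1 : G) O' & forall l, l \in s ->
    exists2 g, N0 (l ^ g) & forall x, E x -> O' x -> (E `&` O0) (x ^ g).
  elim: s sA0 {gs} => [|l s IH] sA0; first by exists setT; [exact: filterT|].
  have [|O' nO' O'P] := IH; first by move=> x xs; apply: sA0; rewrite inE xs orbT.
  have [|g Ng] := sA0 l; first by rewrite inE eqxx.
  have [O1 nO1 O1P] := cmm_all g.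
  exists (O' `&` (O1 `&` [set x | O0 (x ^ g)])).
    by apply: filterI => //; apply: filterI => //; apply: nbhs_conj.
  move=> m; rewrite inE => /orP[/eqP ->|/O'P[h Nh hP]].
    by exists g => // x Ex [_ [O1x O0x]]; split=> //; apply: O1P.
  by exists h => // x Ex [O'x _]; apply: hP.
have [O gO OO'] := goodP _ nO'.
have [sO nO OU OJ] := gO.
pose H := iter k derived (E `&` O).
have sH : is_subgroup H by apply: iter_derived_subgroup; exact: sEO.
(* [H] is stable under generators of [G] and contained in the proper subgroup [U], so it is trivial,
   which contradicts minimality. *)
apply: (kmin' O gO); suff eH : H = [set 1] by rewrite /Q -/H eH.
apply: (normal_in_proper HG sH _ clU UT); last first.
  by move=> x /(iter_derived_sub (sEO O gO))[_ /OU].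
apply: (stable_gen gs) => g [Ug|gin] x Hx.
  have UH u y : U u -> H y -> H (y ^ u).
    move=> Uu; apply: iter_derivedJ => z [Ez Oz].
    by split; [exact: EU|exact: OJ].
  by split; apply: UH => //; apply: subgroupV.
have [h Nh hP] := O'P g gin.
(* The conjugates by [h] of [x] and of [g] both lie in the abelian group [N0], so [x] and [g]
   commute. *)
have NHx : N0 (x ^ h).
  move: Hx; apply: iter_derivedJ => z [Ez Oz]; apply: hP => //; exact: OO'.
have xg : x ^ g = x.
  by apply: (@conjg_inj _ h); rewrite conjJg N0c.
by split; rewrite ?xg // -{1}xg conjgK.
Qed.

(** The closure of a soluble subgroup is soluble because the trivial subgroup is closed, and the
    closure of [K] contains a neighbourhood of 1 in [L]. *)
Lemma virtually_soluble_trivial L : locally_normal L -> virtually_soluble L -> L = [set 1].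
Proof.
move=> nL [K [sK KL fK [n solK]]].
have [W nW LW] := finite_index_closure sK fK.
apply: (locally_normal_soluble (n := n) nL nW) => x /(iter_derivedS LW).
move=> /iter_derived_closure; rewrite solK -(iffLR (closure_id _)) //.
exact: closed1.
Qed.

End ClosureSoluble.

(** * Prime content *)

Lemma subgroupI (G : groupType) (H K : set G) : is_subgroup H -> is_subgroup K ->
  is_subgroup (H `&` K).
Proof.
move=> sH sK; split; first by split; exact: subgroup1.
  by move=> x y [Hx Kx] [Hy Ky]; split; exact: subgroupM.
by move=> x [Hx Kx]; split; exact: subgroupV.
Qed.

Section Primes.
Variable G : topologicalGroupType.
Implicit Types (H K L U V W : set G) (pi : nat_pred).

(** A kernel for [pi2] inside a kernel [N] for [pi1] exhibits the same finite quotient [H / N] as a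
    group for both sets of primes. *)
Lemma residually_piI pi1 pi2 pi H : (forall p, p \in pi1 -> p \in pi2 -> p \in pi) ->
  residually (pi_class pi1) H -> residually (pi_class pi2) H -> residually (pi_class pi) H.
Proof.
move=> sub [sH p1] [_ p2]; split=> // W /p1[N [NW rN q1]].
exists N; split=> //; have [O nO HO] := rN.
have [N2 [N2O _ q2]] := p2 _ nO.
have N2N : N2 `<=` N by move=> x Nx; apply: HO; split; [exact: (quot_in_sub q2)|exact: N2O].
have [gT [A [f [_ _ mf eN]]]] := q1.
have [B BE] := image_group sH mf.
have BE' y : y \in B -> exists2 x, H x & f x = y by move/BE.
have NK : N `<=` ker_on H f by rewrite eN.
have B1 : pi1.-group B := quot_in_image sH mf q1 NK BE'.
have B2 : pi2.-group B := quot_in_image sH mf q2 (subset_trans N2N NK) BE'.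
exists gT, B, f; split=> //; last by move=> x Hx; apply/BE; exists x.
apply/pgroupP => p pp pB; apply: sub; [exact: (pgroupP B1)|exact: (pgroupP B2)].
Qed.

Lemma residually_piS pi1 pi2 H : (forall p, p \in pi1 -> p \in pi2) ->
  residually (pi_class pi1) H -> residually (pi_class pi2) H.
Proof. by move=> sub p1; apply: (residually_piI (pi1 := pi1) (pi2 := pi1)) => // p /sub. Qed.

Lemma residually_pro_pi pi H : hausdorff_space G -> compact H ->
  residually (pi_class pi) H -> pro_pi pi H.
Proof.
move=> hG cH pH; apply: (residually_pro hG cH pH) => gT.
by rewrite /= /pgroup cardsT.
Qed.

Lemma relatively_open_compact L U : hausdorff_space G -> is_subgroup L -> compact L ->
  is_subgroup U -> (exists2 V, open V & U = L `&` V) -> compact U.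
Proof.
move=> hG sL cL sU [V oV eU].
have UL : U `<=` L by rewrite eU => x [].
apply: (subclosed_compact _ cL UL).
apply: (relopen_closed sL (compact_closed hG cL) sU UL).
exists V; last by rewrite eU.
by apply: open_nbhs_nbhs; split=> //; have := subgroup1 sU; rewrite eU => -[].
Qed.

Hypothesis HG : class_S G.
Let hG := class_S_hausdorff HG.

(** The envelope of a compact open [U] is used only for its generating set [D]. With [r = 0] and
    [X = U] the hypothesis of [fixb_residually] is immediate, so the primes dividing the order of
    one finite group suffice. *)
Lemma local_primes : exists s : seq nat, (forall p, p \in s -> prime p) /\
  exists K, [/\ is_subgroup K, open K & residually (pi_class [pred p in s]) K].
Proof.
have [U [sU oU cU UT]] := proper_compact_open HG.
have nU := open_nbhs1 sU oU.
have U1 : U <> [set 1] by move=> e; apply: (not_nbhs1 HG); rewrite -e.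
have nlU : locally_normal U.
  split=> //; rewrite openE => g ng; rewrite /interior /=.
  apply/nbhs_mulr; apply: filterS nU => u Uu.
  have e : [set x ^ u | x in U] = U.
    apply/seteqP; split=> [_ [x Ux <-]|x Ux]; first exact: subgroupJ.
    by exists (x ^ u^-1); rewrite ?conjgKV //; apply: subgroupJ => //; apply: subgroupV.
  rewrite /normaliser /= -{2}ng -[in RHS]e; apply/seteqP; split=> [_ [x Ux <-]|].
    by exists (x ^ u); [exists x|rewrite conjgM].
  by move=> _ [_ [x Ux <-] <-]; exists x; rewrite // conjgM.
have [D [V [A [E [MM env]]]]] := envelope_ex HG sU oU cU nlU U1 nU.
case: env => cD D1 UD DV gD _ _ _ _ _ _ _ _ _ _ _.
have [gT [f [mf eK]]] := fixb_fin_quot sU oU cU cD D1 UD 0 1.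
exists (primes #|gT|); split; first by move=> p; rewrite mem_primes => /andP[].
exists (fixb U D 1); split; [exact: fixb_subgroup|exact: fixb_open|].
have P1 hT : pi_class [pred p in primes #|gT|] hT 1%G by exact: pgroup1.
have qU : quot_in (pi_class [pred p in primes #|gT|]) U (fixb U D 1).
  exists gT, [set: gT]%G, f; split=> //; last by move=> x _; rewrite finset.in_setT.
  rewrite /= /pgroup cardsT; apply/pnatP; first by apply/card_gt0P; exists 1.
  by move=> p pp pd; rewrite !inE mem_primes pp pd andbT; apply/card_gt0P; exists 1.
apply: (fixb_residually HG sU oU cU UT cD D1 UD DV gD P1 qU) => m x g Kx wg.
exact: (iffLR (fixb_add sU UD m.+1 0 x) Kx).
Qed.

End Primes.

(** * The set of primes and the four assertions *)

Theorem theorem1 (G : topologicalGroupType) (HG : class_S G) :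
  (exists eta : {fset nat},
    [/\ (forall p : nat, p \in eta -> prime p),
        (* (i) *)
        (forall L : set G, locally_normal L ->
           virtually (pro_pi [pred p in eta]) L),
        nbhs (1 : G) =
          filter_from [set U : set G | [/\ is_subgroup U, open U
                                         & pro_pi [pred p in eta] U]] id
        (* (ii) *)
      & (forall p : nat, p \in eta ->
           forall L : set G, locally_normal L -> L <> [set 1] ->
           exists P : set G, [/\ P `<=` L, pro_pi (p : nat_pred) P & infinite_set P])])
  (* (iii) *)
  /\ ((exists L : set G, [/\ locally_normal L, L <> [set 1]
                           & virtually pro_soluble L]) ->
      forall K : set G, is_subgroup K -> compact K -> open K ->
        virtually pro_soluble K)
  (* (iv) *)
  /\ (forall L : set G, locally_normal L /\ virtually_soluble L <-> L = [set 1]).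
Proof.
have hG := class_S_hausdorff HG.
split; last split; last first.
- move=> L; split=> [[nL vL]|->]; first exact: (virtually_soluble_trivial HG).
  have s1 : is_subgroup [set (1 : G)].
    by split; [|move=> _ _ -> ->; rewrite mulg1|move=> _ ->; rewrite invg1].
  split.
    split=> //; first exact: compact_set1.
    suff -> : normaliser [set (1 : G)] = setT by exact: openT.
    apply/seteqP; split=> // g _; rewrite /normaliser /=; apply/seteqP; split.
      by move=> _ [_ -> <-]; rewrite conj1g.
    by move=> _ ->; exists 1; rewrite ?conj1g.
  exists [set 1]; split=> //; last by exists 0%N.
  by apply: finite_image; exact: finite_set1.
- move=> [L [nL L1 [U0 [sU0 [V oV eU0] psU0]]]] K sK cK oK.
  have [sL cL _] := nL.
  have cU0 : compact U0.
    by apply: (relatively_open_compact hG sL cL sU0); exists V.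
  have nV : nbhs (1 : G) V.
    by apply: open_nbhs_nbhs; split=> //; have := subgroup1 sU0; rewrite eU0 => -[].
  have P1 gT : solvable_class gT 1%G by exact: solvable1.
  have pL : residually solvable_class (L `&` V).
    by rewrite -eU0; apply: (pro_residually hG cU0 _ psU0).
  have [K0 [sK0 oK0 cK0 pK0]] := open_residually HG P1 nL L1 nV pL.
  have sKK : is_subgroup (K `&` K0) by exact: subgroupI.
  exists (K `&` K0); split=> //; first by exists K0.
  have cKK : compact (K `&` K0).
    by apply: (relatively_open_compact hG sK cK sKK); exists K0.
  by apply: (residually_pro hG cKK (residuallyS sKK _ pK0)) => // x [].
have [s [sp [K1 [sK1 oK1 pK1]]]] := local_primes HG.
(* The set [eta] keeps the primes of [s] for which [G] is not locally pro-p'. *)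
pose local_p' p := exists K : set G, [/\ is_subgroup K, open K & residually (pi_class (negn p)) K].
have [eta etaP] : exists eta : {fset nat},
    forall p, p \in eta <-> p \in s /\ ~ local_p' p.
  exists [fset p in s | ~~ `[< local_p' p >]]%fset => p.
  rewrite !inE /=; split=> [/andP[ps /asboolPn]|[ps /asboolPn np]] //.
  by rewrite ps.
have [K [sK oK pK]] : exists K : set G, [/\ is_subgroup K, open K &
    residually (pi_class [pred p in eta]) K].
  (* Induction on [t] removes its primes outside [eta] one at a time, intersecting with an open
     subgroup that avoids the prime; the case [t = s] leaves only [eta]. *)
  have H (t : seq nat) : exists K : set G, [/\ is_subgroup K, open K &
      residually (pi_class [pred p | (p \in s) && ((p \in t) ==> (p \in eta))]) K].
    elim: t => [|p t [K [sK oK pK]]].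
      exists K1; split=> //; apply: residually_piS pK1 => p.
      by rewrite !inE => ->.
    have [p_eta|p_eta] := boolP (p \in eta).
      exists K; split=> //; apply: residually_piS pK => q.
      rewrite !inE => /andP[-> /=]; case: eqP => //= ->.
      by rewrite p_eta implybT.
    have [ps|ps] := boolP (p \in s); last first.
      exists K; split=> //; apply: residually_piS pK => q.
      rewrite !inE => /andP[qs]; rewrite qs; case: eqP => //= e.
      by move: ps; rewrite -e qs.
    have [K' [sK' oK' pK']] : local_p' p.
      by apply: contrapT => np; move/negP: p_eta; apply; apply/etaP.
    have sKK : is_subgroup (K `&` K') by exact: subgroupI.
    exists (K `&` K'); split=> //; first exact: openI.
    apply: (residually_piI _ (residuallyS sKK _ pK) (residuallyS sKK _ pK')); [|by move=> x []..].
    move=> q; rewrite !inE => /andP[-> /= qt] nq.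
    by rewrite (negPf nq).
  have [K [sK oK pK]] := H s; exists K; split=> //; apply: residually_piS pK => p.
  by rewrite !inE => /andP[->].
have pro_sub (H : set G) : is_subgroup H -> compact H -> H `<=` K ->
    pro_pi [pred p in eta] H.
  by move=> sH cH HK; apply: residually_pro_pi => //; apply: residuallyS pK.
exists eta; split.
- by move=> p /etaP[/sp].
- move=> L [sL cL _].
  have sLK : is_subgroup (L `&` K) by exact: subgroupI.
  exists (L `&` K); split=> //; first by exists K.
  apply: pro_sub => //.
  by apply: (relatively_open_compact hG sL cL sLK); exists K.
- rewrite predeqE => W; split=> [nW|[U [sU oU _] UW]]; last first.
    by apply: filterS UW _; exact: open_nbhs1.
  have nWK : nbhs (1 : G) (W `&` K) by apply: filterI => //; exact: open_nbhs1.
  have [U [sU oU cU UW]] := compact_open_subgroup HG nWK.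
  exists U; last by move=> x /UW[].
  by split=> //; apply: pro_sub => // x /UW[].
move=> p /etaP[ps np] L nL L1; have [sL cL _] := nL.
have [U [sU oU cU UT]] := proper_compact_open HG.
have nU := open_nbhs1 sU oU.
have [D [V [A [E [MM env]]]]] := envelope_ex HG sU oU cU nL L1 nU.
case: env => cD D1 UD DV gD _ _ _ _ _ _ _ _ _ _ _.
pose M n := L `&` fixb U D n.
have sLU : is_subgroup (L `&` U) by exact: subgroupI.
have cLU : compact (L `&` U).
  by apply: compact_closedI => //; apply: compact_closed.
have nf n := fixb_nbhs sU oU cD n.
have ML n : (L `&` U) `&` fixb U D n = M n.
  apply/seteqP; split=> x; first by move=> [[Lx _] Kx].
  by move=> [Lx Kx]; split=> //; split=> //; apply: fixbU Kx.
have [||||[Q [QL cQ pQ iQ]]|[n pM]] := @sylow_dichotomy G p (L `&` U) M hG sLU cLU.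
- move=> n; rewrite -ML; apply: (@fin_quotS _ U).
    by move=> x [].
  by have := fixb_fin_quot sU oU cU cD D1 UD 0 n; rewrite addn0.
- by move=> n; exists (fixb U D n) => // x [[Lx _] Kx].
- by move=> n x [Lx Kx]; split=> //; apply: fixbS Kx.
- move=> W nW; have [n nKW] := fixb_small HG sU oU cU UT cD D1 DV gD nW.
  by exists n => x [_ /nKW].
- exists Q; split=> //; first by move=> x /QL[].
  exact: residually_pro_pi.
(* In the other alternative some relatively open [M n] in [L] is locally free of [p]; then [G] is
   locally pro-p', contrary to the choice of [eta]. *)
have P1 gT : pi_class (negn p) gT 1%G by exact: pgroup1.
have [K' [sK' oK' _ pK']] := open_residually HG P1 nL L1 (nf n) pM.
by case: np; exists K'.
Qed.
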